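(* Sampling from $\nu_c$ is polynomial-time solvable on the class of graphs of treewidth at most $2$: there is a probabilistic algorithm which, given a graph $G$ of treewidth at most $2$ and a weight function $c:E(G)\to\mathbb{Q}_{\ge 0}$ (not making all simple cycles weight zero), outputs a simple cycle of $G$ distributed exactly according to $\nu_c$, in time polynomial in the size of $(G,c)$.
   Context: For a graph $G$ and $c:E(G)\to\mathbb{Q}_{\ge0}$, $N_c$ is the measure on the set of simple cycles of $G$ giving each simple cycle $C$ weight $N_c(C)=\prod_{e\in C}c(e)$, and $\nu_c$ is the probability distribution obtained by normalizing $N_c$. *)

(* Defs.v *)
From mathcomp Require Import all_boot all_order all_algebra.

Set Implicit Arguments.
Unset Strict Implicit.
Unset Printing Implicit Defensive.

Import Order.TTheory GRing.Theory Num.Theory.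

(* Graphs are finite and simple: a symmetric irreflexive relation on the
   vertices.  Edges are the two-element sets of adjacent vertices. *)

Definition edge_set (V : finType) (G : rel V) : {set {set V}} :=
  [set E | [exists x, exists y, G x y && (E == [set x; y])]].

Definition cycle_edges (V : finType) (p : seq V) : {set {set V}} :=
  [set [set x; next p x] | x in p].

(* A simple cycle is a subgraph, given by its set of edges, so that the choice
   of a starting point and of a direction is forgotten.  The bound on k only
   serves decidability: p has no repetition, so its length is at most #|V|. *)
Definition simple_cycle (V : finType) (G : rel V) (C : {set {set V}}) : bool :=
  [exists k : 'I_#|V|.+1, exists p : k.-tuple V,
     [&& 2 < k, ucycleb G p & C == cycle_edges p]].

Definition is_tree (U : finType) (t : rel U) : Prop :=
  [/\ symmetric t, irreflexive t, 0 < #|U|,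
      forall u w, connect t u w & forall C, ~~ simple_cycle t C].

Definition tree_decomposition (V : finType) (G : rel V)
    (U : finType) (t : rel U) (B : U -> {set V}) : Prop :=
  [/\ is_tree t,
      forall x, exists u, x \in B u,
      forall x y, G x y -> exists u, (x \in B u) && (y \in B u)
    & forall x u w, x \in B u -> x \in B w ->
        connect (fun a b => [&& t a b, x \in B a & x \in B b]) u w].

Definition treewidth_at_most (V : finType) (G : rel V) (k : nat) : Prop :=
  exists (U : finType) (t : rel U) (B : U -> {set V}),
    tree_decomposition G t B /\ forall u, #|B u| <= k.+1.

Section CycleMeasure.
Local Open Scope ring_scope.

(* Only the values of c on edge_set G matter. *)
Definition cycle_weight (V : finType) (c : {set V} -> rat)
    (C : {set {set V}}) : rat := \prod_(E in C) c E.

Definition cycle_distr (V : finType) (G : rel V) (c : {set V} -> rat)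
    (C : {set {set V}}) : rat :=
  if simple_cycle G C then
    cycle_weight c C / \sum_(D | simple_cycle G D) cycle_weight c D
  else 0.

End CycleMeasure.

(* The model of computation is a random access machine under the logarithmic
   cost criterion, with structured control flow: memory cells hold arbitrary
   natural numbers, the input is a read-once tape and the output a write-once
   tape of natural numbers.  Exact sampling from a rational distribution is
   impossible in bounded time with fair coins alone, so, as in Jerrum, Valiant
   and Vazirani (1986), the machine may toss a coin whose bias is a ratio of two
   integers that it has computed. *)

Inductive binop := Add | Sub | Mul | Div.

Inductive expr :=
  | Const of nat
  | Get of expr                 (* content of the cell with computed address *)
  | Op of binop & expr & expr.

Inductive cmd :=
  | Store of expr & expr        (* address, value *)
  | Read of expr                (* address that receives the next input item *)
  | Write of expr
  | Toss of expr & expr & expr  (* address, numerator, denominator *)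
  | Seq of cmd & cmd
  | If of expr & cmd & cmd
  | While of expr & cmd.

Definition nbits (n : nat) : nat := (trunc_log 2 n).+1.

(* Subtraction is truncated, and m %/ 0 = 0. *)
Definition eval_op (o : binop) : nat -> nat -> nat :=
  match o with Add => addn | Sub => subn | Mul => muln | Div => divn end.

Fixpoint eval (m : nat -> nat) (e : expr) : nat :=
  match e with
  | Const k => k
  | Get a => m (eval m a)
  | Op o e1 e2 => eval_op o (eval m e1) (eval m e2)
  end.

(* Every value that occurs (operand, address or result) is charged its length
   in binary. *)
Fixpoint cost (m : nat -> nat) (e : expr) : nat :=
  nbits (eval m e) +
  match e with
  | Const _ => 0
  | Get a => cost m a
  | Op _ e1 e2 => cost m e1 + cost m e2
  end.

Record state := State {
  mem : nat -> nat;
  inp : seq nat;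
  out : seq nat;
  clock : nat }.

Definition upd (m : nat -> nat) (a v : nat) : nat -> nat :=
  fun b => if b == a then v else m b.

(* A configuration is the stack of commands still to be executed, together with
   a state; the machine has halted when the stack is empty. *)
Definition config := (seq cmd * state)%type.

Definition halted (g : config) : bool := nilp g.1.

(* With q = 0 the quotient is 0, and a ratio above 1 counts as 1. *)
Definition bias (p q : nat) : rat := Num.min 1%R (p%:R / q%:R)%R.

(* The machine is a Markov chain: a step returns the list of the possible next
   configurations with their probabilities. *)
Definition step (g : config) : seq (rat * config) :=
  let: (k, s) := g in
  let: State m i o t := s in
  match k with
  | [::] => [:: (1%R, g)]
  | Store a e :: k' =>
      [:: (1%R, (k', State (upd m (eval m a) (eval m e)) i o
                       (t + (cost m a + cost m e).+1)))]
  | Read a :: k' =>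
      [:: (1%R, (k', State (upd m (eval m a) (head 0 i)) (behead i) o
                       (t + (cost m a + nbits (head 0 i)).+1)))]
  | Write e :: k' =>
      [:: (1%R, (k', State m i (rcons o (eval m e)) (t + (cost m e).+1)))]
  | Toss a p q :: k' =>
      let r := bias (eval m p) (eval m q) in
      let t' := t + (cost m a + cost m p + cost m q).+1 in
      [:: (r, (k', State (upd m (eval m a) 1) i o t'));
          ((1 - r)%R, (k', State (upd m (eval m a) 0) i o t'))]
  | Seq c1 c2 :: k' => [:: (1%R, (c1 :: c2 :: k', State m i o t.+1))]
  | If e c1 c2 :: k' =>
      [:: (1%R, ((if eval m e != 0 then c1 else c2) :: k',
                 State m i o (t + (cost m e).+1)))]
  | While e c :: k' =>
      [:: (1%R, (if eval m e != 0 then c :: While e c :: k' else k',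
                 State m i o (t + (cost m e).+1)))]
  end.

(* Distribution after N steps; the same configuration may be listed several
   times. *)
Fixpoint run (N : nat) (g : config) : seq (rat * config) :=
  if N is N'.+1 then
    flatten [seq [seq ((b.1 * d.1)%R, d.2) | d <- run N' b.2] | b <- step g]
  else [:: (1%R, g)].

Definition init (P : cmd) (x : seq nat) : config :=
  ([:: P], State (fun=> 0) x [::] 0).

(* On input x, the program P halts within time T on every branch of positive
   probability, and the law of its output is the image of mu under enc. *)
Definition samples_in_time (P : cmd) (x : seq nat) (T : nat)
    (A : finType) (enc : A -> seq nat) (mu : A -> rat) : Prop :=
  exists N : nat,
    all (fun b => (b.1 == 0%R) || (halted b.2 && (clock b.2.2 <= T)))
        (run N (init P x))
    /\ forall y : seq nat,
         (\sum_(b <- run N (init P x) | halted b.2 && (out b.2.2 == y)) b.1 =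
          \sum_(a | enc a == y) mu a)%R.

(* Input: the number of vertices, then row by row the adjacency matrix, with
   for each edge the numerator and denominator of its weight in lowest terms. *)
Definition encode_input (n : nat) (G : rel 'I_n) (c : {set 'I_n} -> rat) :
    seq nat :=
  n :: flatten [seq (if G x y then
                       [:: 1; `|numq (c [set x; y])|; `|denq (c [set x; y])|]
                     else [:: 0; 0; 0])
               | x <- enum 'I_n, y <- enum 'I_n].

(* Output: the adjacency matrix of the cycle, row by row.  This determines any
   set of two-element sets of vertices. *)
Definition encode_cycle (n : nat) (C : {set {set 'I_n}}) : seq nat :=
  [seq nat_of_bool ([set x; y] \in C) | x <- enum 'I_n, y <- enum 'I_n].

Definition size_bits (x : seq nat) : nat := sumn (map nbits x).

(* Main.v *)
Require Import Defs.
From mathcomp Require Import all_boot all_order all_algebra.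
From mathcomp Require Import zify ring lra.

(** No elimination order is computed: every vertex is tried in turn, in n rounds over all n
    vertices. An attempt at a vertex with no neighbour or with more than two changes nothing and
    yields a degenerate record of triangle weight zero, so the list of records has the fixed length
    n * n. Each round isolates at least one vertex while an edge is left, because treewidth at most
    2 survives eliminations: adding ab and deleting v is at most a contraction of v into a.

    Non-edges and deleted edges are just pairs of weight zero. All sums therefore range over the
    cycles of the complete graph, and an elimination changes the weights only.

    Random steps are treated as operators on test functions f. One identity, valid for every f, then
    gives both the total weight (f = 1) and the law of the output.

    Before the first undo there is no cycle, and the state is the empty set. It survives only until
    the first record of positive triangle weight: that weight is then the whole partial sum, and the
    triangle is taken with probability 1. *)

(* A graph of treewidth at most 2 has a vertex v of degree at most 2.  If v has
   the two neighbours a and b, the cycles through v are the triangle v a b and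
   the cycles obtained from a cycle of G - v + ab by replacing the edge ab by the
   path a v b; so v can be eliminated by adding w(va) w(vb) to the weight of ab
   and setting aside the weight w(va) w(vb) w(ab) of the triangle.  The total
   weight of the cycles is the sum of the triangle weights of all eliminations.
   The sampler undoes the eliminations from the last to the first: at each one
   it replaces the current cycle by the triangle with probability (triangle
   weight) / (sum of the triangle weights met so far), and otherwise, if the
   cycle uses ab, replaces ab by a v b with probability w(va) w(vb) / w'(ab).

   Fractions are never reduced.  Their size stays polynomial because an
   elimination consumes three edges and creates one, so the product over all
   edges of (numerator + denominator) does not increase. *)

Set Implicit Arguments.
Unset Strict Implicit.
Unset Printing Implicit Defensive.

Import Order.TTheory GRing.Theory Num.Theory.

(** * Vertices of small degree in graphs of treewidth two *)

Lemma simple_cycleP (V : finType) (G : rel V) (C : {set {set V}}) :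
  reflect (exists p, [/\ 2 < size p, cycle G p, uniq p & C = cycle_edges p])
          (simple_cycle G C).
Proof.
apply: (iffP existsP) => [[k /existsP[p /and3P[k2 /andP[cp up] /eqP ->]]]|].
  by exists p; split=> //; rewrite size_tuple.
move=> [p [p2 cp up ->]].
have pV : size p < #|V|.+1 by rewrite ltnS -(card_uniqP up) max_card.
exists (Ordinal pV); apply/existsP; exists (in_tuple p).
by rewrite /= p2 /ucycleb cp up eqxx.
Qed.

(** A path from x to y that avoids u would close up through u to a simple cycle of t. *)
Lemma acyclic_neighbours_disconnected (U : finType) (t : rel U) u x y :
  symmetric t -> irreflexive t -> (forall C, ~~ simple_cycle t C) ->
  t u x -> t u y -> x != y ->
  ~~ connect (fun a b => [&& t a b, a != u & b != u]) x y.
Proof.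
move=> st it at_ ux uy xy; apply/negP => /connectP[p0 /shortenP[p pp up _] ey].
have xu : x != u by apply: contraTneq ux => ->; rewrite it.
have pu : u \notin p.
  elim: p x pp {up ux ey xy xu} => //= z p IH x /andP[/and3P[_ _ zu] /IH].
  by rewrite inE negb_or eq_sym zu.
have tp : path t x p by apply: sub_path pp => a b /and3P[].
case/negP: (at_ (cycle_edges (u :: x :: p))); apply/simple_cycleP.
exists (u :: x :: p); split=> //.
- by case: p ey {pp up pu tp} => //= ey; rewrite ey eqxx in xy.
- by rewrite /= rcons_path ux tp -ey st.
- by rewrite cons_uniq inE negb_or eq_sym xu pu up.
Qed.

Definition bag_path (V U : finType) (t : rel U) (B : U -> {set V}) (x : V) : rel U :=
  fun a b => [&& t a b, x \in B a & x \in B b].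

(** The hypothesis in a form that contraction preserves while the vertex type stays [V]: once v is
    contracted into a, it lies in no bag. *)
Definition tw2 (V : finType) (g : rel V) : Prop :=
  exists (U : finType) (t : rel U) (B : U -> {set V}),
    [/\ [/\ symmetric t, irreflexive t & forall C, ~~ simple_cycle t C],
        forall u, #|B u| <= 3,
        forall x y, g x y -> exists u, (x \in B u) && (y \in B u)
      & forall x u w, x \in B u -> x \in B w -> connect (bag_path t B x) u w].

Lemma tw2_treewidth (V : finType) (g : rel V) : treewidth_at_most g 2 -> tw2 g.
Proof.
by move=> [U [t [B [[[st it _ _ at_] _ cov con] sz]]]]; exists U, t, B.
Qed.

Lemma tw2_sub (V : finType) (g h : rel V) : subrel h g -> tw2 g -> tw2 h.
Proof.
by move=> hg [U [t [B [? ? cov con]]]]; exists U, t, B; split=> // x y /hg /cov.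
Qed.

(* Contraction of v into a: v is renamed to a in every bag. *)
Lemma tw2_contract (V : finType) (g h : rel V) (v a : V) :
  symmetric g -> a != v -> g v a ->
  (forall x y, h x y -> [/\ x != v, y != v &
     [|| g x y, (x == a) && g v y | (y == a) && g x v]]) ->
  tw2 g -> tw2 h.
Proof.
move=> sg av gva hg [U [t [B [[st it at_] sz cov con]]]].
pose B' u := if v \in B u then a |: (B u :\ v) else B u.
have inB' x u : x != v -> x \in B u -> x \in B' u.
  by move=> xv xu; rewrite /B'; case: ifP => // _; rewrite !inE xv xu orbT.
have aB' u : v \in B u -> a \in B' u.
  by rewrite /B' => ->; rewrite !inE eqxx.
exists U, t, B'; split=> //.
- move=> u; rewrite /B'; case: ifP => // vu.
  rewrite (leq_trans (leq_of_leqif (leq_card_setU _ _))) // cards1 add1n.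
  by have := cardsD1 v (B u); rewrite vu add1n => <-.
- move=> x y /hg[xv yv /or3P[]].
  + by move=> /cov[u /andP[? ?]]; exists u; rewrite !inB'.
  + move=> /andP[/eqP -> /cov[u /andP[? ?]]]; exists u.
    by rewrite aB' ?inB'.
  + move=> /andP[/eqP -> /cov[u /andP[? ?]]]; exists u.
    by rewrite aB' ?inB'.
(* The bags of v and those of a are connected sets of nodes that meet in u0, so the bags of the
   merged vertex form a connected set. *)
- have [u0 /andP[vu0 au0]] := cov _ _ gva.
  have sym_bp z : connect_sym (bag_path t B' z).
    apply: sym_connect_sym => c d; rewrite /bag_path st.
    by rewrite [X in _ && X]andbC.
  have lift z z' u w : (forall u, z \in B u -> z' \in B' u) ->
     z \in B u -> z \in B w -> connect (bag_path t B' z') u w.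
    move=> zz uz wz; apply: connect_sub (con _ _ _ uz wz) => c d.
    by case/and3P=> tcd zc zd; apply: connect1; rewrite /bag_path tcd !zz.
  move=> x u w; case: (eqVneq x a) => [-> | xa].
    have avU c : a \in B' c -> connect (bag_path t B' a) c u0.
      case: (boolP (v \in B c)) => vc; first by move=> _; apply: (lift v) => //; exact: aB'.
      rewrite /B' (negPf vc) => ac; apply: (lift a) => // ? ; exact: inB'.
    by move=> ua wa; apply: connect_trans (avU _ ua) _; rewrite sym_bp; exact: avU.
  have [->|xv] := eqVneq x v.
    rewrite {1}/B'; case: ifP => [_|->] //.
    by rewrite !inE eqxx /= orbF eq_sym (negPf av).
  have xB c : x \in B' c -> x \in B c.
    by rewrite /B'; case: ifP => // _; rewrite !inE (negPf xa) /= => /andP[].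
  move=> /xB xu /xB xw; apply: (lift x) => // c; exact: inB'.
Qed.

(** Take a minimal part S of the tree that is left only through one node u and contains all bags of
    some non-isolated vertex x. Minimality puts x in [B u], and each neighbour of x is in [B u] as
    well; that bag has at most two elements besides x. *)
Lemma tw2_low_degree (V : finType) (g : rel V) :
  symmetric g -> irreflexive g -> tw2 g -> (exists x y, g x y) ->
  exists x, (exists y, g x y) /\ #|[set y | g x y]| <= 2.
Proof.
move=> sg ig [U [t [B [[st it at_] sz cov con]]]] [x0 [y0 gx0]].
have [u0 /andP[x0u0 _]] := cov _ _ gx0.
(* A branch: a set S of nodes of the tree that can only be left through u. *)
pose branch (S : {set U}) u := [&& u \in S,
  [forall a in S, forall b, t a b && (b \notin S) ==> (a == u)] &
  [exists x, [exists y, g x y] && [forall w, (x \in B w) ==> (w \in S)]]].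
have : exists S, [exists u, branch S u].
  exists setT; apply/existsP; exists u0; rewrite /branch inE /=; apply/andP; split.
    by apply/forall_inP => a _; apply/forallP => b; rewrite inE andbF.
  apply/existsP; exists x0; apply/andP; split; first by apply/existsP; exists y0.
  by apply/forallP => w; rewrite inE implybT.
case=> S1 ex1; have [S minS] := ex_minset (ex_intro (fun S => [exists u, branch S u]) S1 ex1).
have /existsP[u /and3P[uS /forall_inP bS /existsP[x /andP[/existsP[y gxy] /forallP xS]]]] := minsetp minS.
have exits a b : a \in S -> t a b -> b \notin S -> a = u.
  by move=> aS tab nbS; have /forallP /(_ b) := bS _ aS; rewrite tab nbS => /eqP.
(* If z missed u, its bags would lie in a single component S' of the tree without u. Then S' is a
   branch strictly inside S, against minimality. *)
have key z : (exists y, g z y) -> (forall w, z \in B w -> w \in S) -> z \in B u.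
  move=> [z' gz] zS; apply/negPn/negP => zu.
  have [w /andP[zw _]] := cov _ _ gz.
  pose r := fun a b => [&& t a b, a != u & b != u].
  pose S' := [set b | connect r w b].
  have wu : w != u by apply: contraNneq zu => <-.
  have uS' : u \notin S'.
    rewrite inE; apply/negP => /connectP[p pp /esym]; case/lastP: p pp => [_ /= e|p q].
      by rewrite e eqxx in wu.
    by rewrite rcons_path last_rcons => /andP[_ /and3P[_ _ /negPf qu]] e; rewrite e eqxx in qu.
  have S'S : S' \subset S.
    apply/subsetP => b; rewrite inE => /connectP[p pp ->]; move: (zS _ zw).
    elim: p (w) pp => //= b' p IH a /andP[/and3P[tab au _] pp] aS.
    apply: IH => //; apply/negPn/negP => b'S.
    by rewrite (exits _ _ aS tab b'S) eqxx in au.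
  (* S' can be left only towards u, and by acyclicity from one node u' only. If u has no neighbour
     in S', nothing leaves S' and any node serves; the default is w. *)
  pose u' := odflt w [pick c in S' | t u c].
  have u'S : u' \in S'.
    by rewrite /u'; case: pickP => [c /andP[]|] //= _; rewrite inE connect0.
  have : branch S' u'.
    rewrite /branch u'S /=; apply/andP; split.
      apply/forall_inP => a aS'; apply/forallP => b; apply/implyP => /andP[tab bS'].
      have au : a != u by apply: contraNneq uS' => <-.
      have bu : b = u.
        apply/eqP; apply: contraNT bS' => bu; rewrite inE.
        move: aS'; rewrite inE => /connect_trans; apply; apply: connect1.
        by rewrite /r tab au bu.
      subst b; rewrite /u'; case: pickP => [c /andP[cS' tuc]|/(_ a)]; last first.
        by rewrite aS' st tab.
      apply: contraT => ac.
      have tua : t u a by rewrite st.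
      case/negP: (acyclic_neighbours_disconnected st it at_ tua tuc ac).
      have sr : connect_sym r.
        by apply: sym_connect_sym => c1 d1; rewrite /r st [X in _ && X]andbC.
      move: aS' cS'; rewrite !inE sr => wa; exact: connect_trans.
    apply/existsP; exists z; apply/andP; split; first by apply/existsP; exists z'.
    apply/forallP => b; apply/implyP => zb; rewrite inE.
    apply: connect_sub (con _ _ _ zw zb) => c d /and3P[tcd zc zd]; apply: connect1.
    by rewrite /r tcd /=; apply/andP; split; apply: contraNneq zu => <-.
  move=> br; have := minsetinf minS; move/(_ S').
  have -> : [exists u, branch S' u] by apply/existsP; exists u'.
  by move=> /(_ isT S'S) e; rewrite e uS in uS'.
exists x; split; first by exists y.
have xu : x \in B u by apply: key; [exists y | move=> w; exact: (implyP (xS w))].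
have nb : [set z | g x z] \subset B u :\ x.
  apply/subsetP => z; rewrite !inE => gxz.
  have -> : z != x by apply: contraTneq gxz => ->; rewrite ig.
  have [w /andP[xw zw]] := cov _ _ gxz.
  have wS : w \in S by exact: (implyP (xS w)).
  (* A neighbour z of x shares with x a bag in S. If another bag of z lies outside S, the chain of
     bags of z joining the two leaves S, which can happen only at u. *)
  have [/forall_inP zS|] := boolP [forall (w | z \in B w), w \in S].
    by apply: key => //; exists x; rewrite sg.
  case/forall_inPn => w' zw' w'S; have /connectP[p pp ew'] := con _ _ _ zw zw'.
  elim: p (w) wS zw pp ew' => [a aS za _ /= e|b p IH a aS za /= /andP[/and3P[tab _ zb] pp] e].
    by rewrite e aS in w'S.
  have [b_S|b_S] := boolP (b \in S); first exact: IH b_S zb pp e.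
  by rewrite -(exits _ _ aS tab b_S).
rewrite (leq_trans (subset_leq_card nb)) // -ltnS.
by have := cardsD1 x (B u); rewrite xu add1n => <-.
Qed.

(** * Edge sets of cycles and paths *)

Section Cycles.
Variable V : finType.
Implicit Types (x y z v a b : V) (s p : seq V) (C P : {set {set V}}).

Lemma set2_eq x y a b :
  ([set x; y] == [set a; b]) = (x == a) && (y == b) || (x == b) && (y == a).
Proof.
apply/eqP/idP => [e|/orP[] /andP[/eqP-> /eqP->] //]; last exact: setUC.
have := set21 x y; have := set22 x y; have := set21 a b; have := set22 a b.
rewrite {1 2}e -{1 2}e !inE.
do 4! [case/orP=> /eqP ?]; subst; rewrite !eqxx ?orbT //.
Qed.

Fixpoint path_edges x s : {set {set V}} :=
  if s is y :: s' then [set x; y] |: path_edges y s' else set0.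

Lemma path_edges_rcons x s y :
  path_edges x (rcons s y) = [set last x s; y] |: path_edges x s.
Proof. by elim: s x => //= z s IH x; rewrite IH setUCA. Qed.

Lemma path_edges_mem x s E z : E \in path_edges x s -> z \in E -> z \in x :: s.
Proof.
elim: s x => [|y s IH] x /=; first by rewrite inE.
case/setU1P=> [->|/IH h /h zs]; last by rewrite inE zs orbT.
by rewrite !inE => /orP[] ->; rewrite ?orbT.
Qed.

Lemma path_edges_rev x s : exists s',
  last x s :: s' = rev (x :: s) /\ path_edges (last x s) s' = path_edges x s.
Proof.
elim/last_ind: s => [|s y [s' [e1 e2]]]; first by exists [::].
exists (last x s :: s'); rewrite last_rcons -rcons_cons rev_rcons -e1; split=> //=.
by rewrite e2 path_edges_rcons setUC setUC [[set y; _]]setUC.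
Qed.

Lemma cycle_edges_cons x s : uniq (x :: s) ->
  cycle_edges (x :: s) = [set last x s; x] |: path_edges x s.
Proof.
rewrite /cycle_edges.
(* The end of the closing edge is generalised to y0, because the induction removes the head of the
   cycle. *)
have gen y0 : uniq (x :: s) ->
    [set [set z; next_at z y0 x s] | z in x :: s] = [set last x s; y0] |: path_edges x s.
  elim: s x => [|y s IH] x.
    move=> _ /=; rewrite setU0; apply/setP => E; rewrite inE.
    apply/imsetP/eqP => [[z]|->]; first by rewrite inE => /eqP ->; rewrite eqxx.
    by exists x; rewrite ?inE ?eqxx.
  move=> /[dup] /andP[xs _] /andP[_ us]; rewrite [path_edges _ _]/= setUCA -IH //.
  apply/setP => E; rewrite inE; apply/imsetP/orP.
    case=> z; rewrite inE => /predU1P[-> ->|zs ->] /=.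
      by left; rewrite eqxx.
    right; have -> : (z == x) = false by apply: contraNF xs => /eqP <-.
    by apply: imset_f.
  case; first by rewrite inE => /eqP ->; exists x; rewrite ?inE ?eqxx //= eqxx.
  case/imsetP => z zs ->; exists z; first by rewrite inE zs orbT.
  by move=> /=; have -> : (z == x) = false by apply: contraNF xs => /eqP <-.
exact: gen.
Qed.

(** Cycles of the complete graph: the graph is carried by the support of the weights, so the index
    set of the sums is the same before and after an elimination. *)
Definition cyc C := simple_cycle (fun x y => x != y) C.

Lemma uniq_path_neq x s : uniq (x :: s) -> path (fun x y => x != y) x s.
Proof.
elim: s x => //= y s IH x; rewrite inE negb_or -!andbA => /and4P[-> _ ys us] /=.
by apply: IH; rewrite /= ys us.
Qed.

Lemma cycP C : reflect
  (exists x s, [/\ uniq (x :: s), 1 < size s & C = [set last x s; x] |: path_edges x s])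
  (cyc C).
Proof.
apply: (iffP (simple_cycleP _ _)) => [[p [p2 _ up ->]]|[x [s [us s1 ->]]]].
  case: p p2 up => //= x s s1 us; exists x, s; split=> //; exact: cycle_edges_cons.
exists (x :: s); split=> //; last by rewrite cycle_edges_cons.
rewrite /= rcons_path uniq_path_neq //=.
case/lastP: s us s1 => // s y; rewrite last_rcons => /= /andP[xs _] _.
by apply: contraNneq xs => <-; rewrite mem_rcons inE eqxx.
Qed.

Lemma simple_cycle_complete (G : rel V) C : symmetric G -> irreflexive G ->
  simple_cycle G C = cyc C && (C \subset edge_set G).
Proof.
move=> sG iG; apply/simple_cycleP/andP.
  case=> p [p2 cp up ->]; split.
    apply/simple_cycleP; exists p; split=> //.
    case: p cp {p2 up} => //= x s; apply: sub_path => y z; by apply: contraTneq => ->; rewrite iG.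
  apply/subsetP => E /imsetP[x xp ->]; rewrite inE; apply/existsP; exists x.
  by apply/existsP; exists (next p x); rewrite eqxx andbT; exact: next_cycle.
case=> /simple_cycleP[p [p2 _ up ->]] sub; exists p; split=> //.
apply: cycle_from_next => // x xp.
have /(subsetP sub) : [set x; next p x] \in cycle_edges p by apply: imset_f.
rewrite inE => /existsP[y /existsP[z /andP[Gyz]]].
by rewrite set2_eq => /orP[] /andP[/eqP -> /eqP ->] //; rewrite sG.
Qed.

(* Edge sets of the paths from a to b that avoid v. *)
Definition vpath v a b P :=
  [exists k : 'I_#|V|.+1, exists s : k.-tuple V,
    [&& uniq (a :: s), v \notin a :: s, last a s == b & P == path_edges a s]].

Lemma vpathP v a b P : reflect
  (exists s, [/\ uniq (a :: s), v \notin a :: s, last a s = b & P = path_edges a s])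
  (vpath v a b P).
Proof.
apply: (iffP existsP) => [[k /existsP[s /and4P[? ? /eqP ? /eqP ?]]]|].
  by exists s.
move=> [s [us vs ls ->]].
have sV : size s < #|V|.+1.
  have /andP[_ /card_uniqP <-] := us; rewrite ltnS; exact: max_card.
exists (Ordinal sV); apply/existsP; exists (in_tuple s).
by rewrite us vs ls !eqxx.
Qed.

Lemma vpath_sym v a b P : vpath v a b P -> vpath v b a P.
Proof.
case/vpathP=> s [us vs ls ->]; apply/vpathP.
have [s' [e1 e2]] := path_edges_rev a s.
exists s'; rewrite -ls e1 rev_uniq mem_rev us vs e2; split=> //.
have -> : last (last a s) s' = last a (last a s :: s') by [].
by rewrite e1 rev_cons last_rcons.
Qed.

Lemma vpath_avoid v a b P E : vpath v a b P -> E \in P -> v \notin E.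
Proof.
case/vpathP=> s [_ vs _ ->] EP; apply: contra vs; exact: path_edges_mem.
Qed.

Lemma cyc_through v C E : cyc C -> E \in C -> v \in E ->
  exists x y s, [/\ uniq (v :: x :: s), last x s = y, x != y &
                   C = [set v; y] |: ([set v; x] |: path_edges x s)].
Proof.
case/simple_cycleP => p [p2 _ up eC] EC vE.
have vp : v \in p.
  rewrite eC in EC; case/imsetP: EC vE => z zp ->.
  by rewrite !inE => /orP[] /eqP -> //; rewrite mem_next.
have [i s e] := rot_to vp.
have ecy : C = cycle_edges (v :: s).
  rewrite eC -e /cycle_edges; apply/setP => F.
  by apply/imsetP/imsetP => -[z zp ->]; exists z; rewrite ?mem_rot ?next_rot // -(mem_rot i).
have us : uniq (v :: s) by rewrite -e rot_uniq.
rewrite cycle_edges_cons // in ecy.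
have : 1 < size s by have := congr1 size e; rewrite size_rot /=; lia.
case: s us ecy {e} => //= x s us -> s1; exists x, (last x s), s; split=> //.
  case/lastP: s us s1 => // s y us _; rewrite last_rcons.
  move: us; rewrite mem_rcons !inE => /and3P[_ h _].
  by apply: contraNneq h => ->; rewrite eqxx.
by rewrite [[set v; last x s]]setUC.
Qed.

Section Neighbours.
Variables v a b : V.
Hypotheses (va : v != a) (vb : v != b) (ab : a != b).

(** Isolates the one path that uses ab: it closes up through v to the triangle, whereas every other
    path also closes up through ab. *)
Lemma vpath_edge P : vpath v a b P -> [set a; b] \in P -> P = [set [set a; b]].
Proof.
case/vpathP=> -[|y s] [us vs /= ls ->]; first by rewrite inE.
move/andP: us => [as_ us]; rewrite !inE => /orP[|abP]; last first.
  by rewrite (path_edges_mem abP) ?set21 in as_.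
rewrite set2_eq eqxx /= => /orP[/eqP by_|/andP[/eqP ay _]]; last first.
  by rewrite ay inE eqxx in as_.
rewrite by_ in ls *; case: s ls us {as_ vs} => [|z s] /= ls; first by rewrite setU0.
by rewrite -[in X in X \notin _]ls mem_last.
Qed.

Lemma vpath1 : vpath v a b [set [set a; b]].
Proof.
apply/vpathP; exists [:: b]; rewrite /= setU0 !inE negb_or va vb ab; split=> //.
Qed.

(** With [vpath_cyc_through], this makes cycles through va and vb correspond to paths from a to b
    avoiding v. [vpath_cyc] and [cyc_avoid_vpath] do the same for cycles that avoid v and use ab.
    The two families of cycles thus share one index set, on which their weights can be compared. *)
Lemma cyc_vpath C : cyc C -> [set v; a] \in C -> [set v; b] \in C ->
  exists2 P, vpath v a b P & C = [set v; a] |: ([set v; b] |: P).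
Proof.
move=> cC aC bC; have [x [y [s [us ls xy eC]]]] := cyc_through cC aC (set21 _ _).
move/andP: us => [vs us].
have inC z : z != v -> [set v; z] \in C -> (z == x) || (z == y).
  rewrite eC !inE !set2_eq !eqxx /= => zv.
  case/or3P=> [/orP[->|/andP[_ /negPn]]|/orP[->|/andP[_ /negPn]]|h]; rewrite ?orbT ?zv //.
  by rewrite (path_edges_mem h) ?set21 in vs.
have vP : vpath v x y (path_edges x s) by apply/vpathP; exists s.
have ha := inC a; have hb := inC b; rewrite eq_sym in ha; rewrite eq_sym in hb.
have [[ax bx]|[ay bx]] : (a = x /\ b = y) \/ (a = y /\ b = x).
  have := ab; case/orP: (ha va aC) (hb vb bC) => /eqP -> /orP[] /eqP ->;
    rewrite ?eqxx //; tauto.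
- by exists (path_edges x s); rewrite ax bx // setUCA.
- by exists (path_edges x s); rewrite ay bx //; exact: vpath_sym.
Qed.

Lemma vpath_cyc_through P : vpath v a b P -> cyc ([set v; a] |: ([set v; b] |: P)).
Proof.
case/vpathP=> s [us vs ls ->]; apply/cycP; exists v, (a :: s); split.
- by rewrite cons_uniq vs us.
- by case: s ls {us vs} => //= e; have := ab; rewrite e eqxx.
- by rewrite /= ls setUCA [[set b; v]]setUC.
Qed.

Lemma vpath_cyc P : vpath v a b P -> [set a; b] \notin P -> cyc ([set a; b] |: P).
Proof.
case/vpathP=> s [us vs ls ->] abP; apply/cycP; exists a, s; split=> //.
  case: s ls abP {us vs} => [|y [|z s]] //= e; first by have := ab; rewrite e eqxx.
  by rewrite e setU0 inE eqxx.
by rewrite ls [[set b; a]]setUC.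
Qed.

Lemma cyc_avoid_vpath C : cyc C -> {in C, forall E : {set V}, v \notin E} ->
  [set a; b] \in C ->
  exists2 P, vpath v a b P & C = [set a; b] |: P /\ [set a; b] \notin P.
Proof.
case/simple_cycleP => p [p2 _ up eC] vC abC.
have vp : v \notin p.
  apply/negP => vp; have /vC : [set v; next p v] \in C by rewrite eC; apply: imset_f.
  by rewrite set21.
move: (abC); rewrite {1}eC => /imsetP[z zp ez].
have np : next p z \in p by rewrite mem_next.
have [i s e] := rot_to np.
have us : uniq (next p z :: s) by rewrite -e rot_uniq.
have ecy : C = cycle_edges (next p z :: s).
  rewrite eC -e /cycle_edges; apply/setP => F.
  by apply/imsetP/imsetP => -[t tp ->]; exists t; rewrite ?mem_rot ?next_rot // -(mem_rot i).
have lz : last (next p z) s = z.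
  have /andP[qs _] := us; have := prev_next up z.
  by rewrite -(prev_rot i up) e prev_nth mem_head (memNindex qs) -last_nth.
rewrite cycle_edges_cons // lz in ecy.
have s1 : 1 < size s by have := congr1 size e; rewrite size_rot /=; lia.
have vs : v \notin next p z :: s by rewrite -e mem_rot.
set q := next p z in us ecy lz vs ez *.
have P1 : vpath v q z (path_edges q s) by apply/vpathP; exists s.
have nP : [set z; q] \notin path_edges q s.
  case: s {e} us lz s1 {ecy vs P1} => //= y s; rewrite inE negb_or -!andbA.
  move=> /and4P[qy qs ys us] lz s1; rewrite !inE set2_eq negb_or; apply/andP; split.
    rewrite negb_or [q == y](negPf qy) andbF eqxx andbT /=.
    case/lastP: s us s1 ys lz {qs} => // s t _ _; rewrite last_rcons mem_rcons inE => h <-.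
    by apply: contra h => /eqP ->; rewrite eqxx.
  by apply/negP => /path_edges_mem /(_ (set22 _ _)); rewrite inE (negPf qy) (negPf qs).
exists (path_edges q s); last by rewrite ez.
move/eqP: ez; rewrite set2_eq => /orP[] /andP[/eqP -> /eqP ->] //; exact: vpath_sym.
Qed.
End Neighbours.
End Cycles.

(** * Elimination of a vertex of degree two *)

Section Elimination.
Variable V : finType.
Implicit Types (v a b : V) (C P : {set {set V}}).

Definition triangle v a b : {set {set V}} := [set [set v; a]; [set v; b]; [set a; b]].

Definition detour v a b C : {set {set V}} :=
  [set v; a] |: ([set v; b] |: (C :\ [set a; b])).

Local Open Scope ring_scope.

(** The expectation of f after the random replacement of ab by the path a v b, made with probability
    r when ab is in C. *)
Definition mix (v a b : V) (r : rat) (f : {set {set V}} -> rat) C : rat :=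
  if [set a; b] \in C then r * f (detour v a b C) + (1 - r) * f C else f C.

Lemma cycle_weightU1 (c : {set V} -> rat) (E : {set V}) C :
  E \notin C -> cycle_weight c (E |: C) = c E * cycle_weight c C.
Proof. by move=> EC; rewrite /cycle_weight big_setU1. Qed.

Lemma eq_cycle_weight (c d : {set V} -> rat) C : {in C, c =1 d} ->
  cycle_weight c C = cycle_weight d C.
Proof. by move=> cd; apply: eq_bigr. Qed.

Lemma cycle_weight0 (c : {set V} -> rat) (E : {set V}) C :
  E \in C -> c E = 0 -> cycle_weight c C = 0.
Proof. by move=> EC E0; rewrite /cycle_weight (big_setD1 E) //= E0 mul0r. Qed.

Lemma detour_id v a b C : [set v; a] != [set a; b] -> [set v; b] != [set a; b] ->
  [set a; b] \notin C -> detour v a b ([set a; b] |: C) = [set v; a] |: ([set v; b] |: C).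
Proof. by move=> h1 h2 abC; rewrite /detour setU1K. Qed.

Section Degree2.
Variables (v a b : V) (w w' : {set V} -> rat) (r : rat).
Hypotheses (va : v != a) (vb : v != b) (ab : a != b).
Hypothesis w_supp : forall x, x != v -> w [set v; x] != 0 -> x = a \/ x = b.
Hypothesis w'_v : forall x, x != v -> w' [set v; x] = 0.
Hypothesis w'_ab : w' [set a; b] = w [set a; b] + w [set v; a] * w [set v; b].
Hypothesis w'_eq : forall E : {set V}, v \notin E -> E != [set a; b] -> w' E = w E.
Hypothesis r_eq : r * w' [set a; b] = w [set v; a] * w [set v; b].

Let va_vb : [set v; a] != [set v; b].
Proof. by rewrite set2_eq eqxx (negPf ab) (negPf vb). Qed.

Let va_ab : [set v; a] != [set a; b].
Proof. by rewrite set2_eq (negPf va) (negPf vb). Qed.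

Let vb_ab : [set v; b] != [set a; b].
Proof. by rewrite set2_eq (negPf va) (negPf vb). Qed.

Let v_notin_ab : v \notin [set a; b].
Proof. by rewrite !inE negb_or va vb. Qed.

(** A cycle through v that does not use both va and vb has an edge of weight zero at v. The others
    are reindexed by the path left after removing these two edges. *)
Lemma sum_cyc_through (f : {set {set V}} -> rat) :
  \sum_(C | cyc C && [exists E in C, v \in E]) cycle_weight w C * f C =
  \sum_(P | vpath v a b P) w [set v; a] * w [set v; b] * cycle_weight w P *
     f ([set v; a] |: ([set v; b] |: P)).
Proof.
rewrite (bigID (fun C => ([set v; a] \in C) && ([set v; b] \in C))) /= addrC.
rewrite big1 ?add0r; last first.
  move=> C /andP[/andP[cC /existsP[E /andP[EC vE]]] nab].
  have [x [y [s [us ls xy eC]]]] := cyc_through cC EC vE.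
  have xv : x != v by case/andP: us; rewrite inE negb_or eq_sym => /andP[].
  have yv : y != v.
    by case/andP: us => h _; apply: contraNneq h => <-; rewrite -ls mem_last.
  have xC : [set v; x] \in C by rewrite eC !inE eqxx orbT.
  have yC : [set v; y] \in C by rewrite eC !inE eqxx.
  have [wx|wx] := eqVneq (w [set v; x]) 0; first by rewrite (cycle_weight0 xC wx) mul0r.
  have [wy|wy] := eqVneq (w [set v; y]) 0; first by rewrite (cycle_weight0 yC wy) mul0r.
  exfalso; move: nab xC yC xy.
  by case: (w_supp xv wx) (w_supp yv wy) => -> [] ->;
    rewrite ?eqxx // => /negP nab h1 h2 _; apply: nab; rewrite h1 h2.
pose h P : {set {set V}} := [set v; a] |: ([set v; b] |: P).
pose h' C : {set {set V}} := (C :\ [set v; a]) :\ [set v; b].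
have hK P : vpath v a b P -> h' (h P) = P.
  move=> vP; rewrite /h' /h setU1K ?setU1K //.
    by apply/negP => /(vpath_avoid vP); rewrite set21.
  rewrite !inE (negPf va_vb) /=.
  by apply/negP => /(vpath_avoid vP); rewrite set21.
rewrite (reindex_onto h h') /=; last first.
  move=> C /andP[_ /andP[aC bC]]; rewrite /h /h' [_ :\ _ :\ _]setDDl.
  rewrite setUA -setDDl; apply/setP => E; rewrite !inE.
  by case: eqP => [->|_] /=; [rewrite aC | case: eqP => [->|_] //=; rewrite bC].
apply: eq_big => P.
  apply/idP/idP => [/andP[/andP[/andP[cP _] /andP[aP bP]] /eqP eP]|vP].
    by have [Q vQ eQ] := cyc_vpath va vb ab cP aP bP; rewrite -eP eQ hK.
  rewrite hK // eqxx andbT vpath_cyc_through // !inE !eqxx orbT /= !andbT.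
  by apply/existsP; exists [set v; a]; rewrite !inE !eqxx.
move=> /andP[/andP[/andP[cP _] /andP[aP bP]] /eqP eP].
rewrite /h !cycle_weightU1; first by rewrite !mulrA.
  by rewrite -eP /h' !inE eqxx.
by rewrite -eP /h' !inE eqxx (negPf va_vb) andbF.
Qed.

(** The weight u is arbitrary because the identity is applied both to w and to w'. *)
Lemma sum_cyc_edge (u : {set V} -> rat) (f : {set {set V}} -> rat) :
  \sum_(C | cyc C && ~~ [exists E in C, v \in E] && ([set a; b] \in C))
      cycle_weight u C * f C =
  \sum_(P | vpath v a b P && ([set a; b] \notin P))
     u [set a; b] * cycle_weight u P * f ([set a; b] |: P).
Proof.
pose h P : {set {set V}} := [set a; b] |: P.
rewrite (reindex_onto h (fun C => C :\ [set a; b])) /=; last first.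
  by move=> C /andP[_ abC]; rewrite /h setD1K.
have hK P : [set a; b] \notin P -> h P :\ [set a; b] = P by move=> abP; rewrite /h setU1K.
apply: eq_big => P.
  apply/idP/andP => [/andP[/andP[/andP[cP /existsPn nv] abP] /eqP eP]|[vP abP]].
    have nv' : {in h P, forall E : {set V}, v \notin E}.
      by move=> E EP; have := nv E; rewrite EP.
    have [Q vQ [eQ abQ]] := cyc_avoid_vpath va vb ab cP nv' abP.
    suff -> : P = Q by [].
    by rewrite -eP eQ -{2}(hK Q).
  rewrite hK // eqxx (vpath_cyc ab vP abP) !inE eqxx /= !andbT.
  apply/existsPn => E; rewrite !inE; apply/negP => /andP[/orP[/eqP ->|EP]].
    exact: (negP v_notin_ab).
  exact: (negP (vpath_avoid vP EP)).
move=> /andP[_ /eqP eP]; rewrite /h cycle_weightU1 //.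
by rewrite -eP !inE eqxx.
Qed.

(** Both sides are sums over the paths P from a to b avoiding v. The path ab gives the triangle. Any
    other P gives on the left the two cycles P + a v b and P + ab, and on the right only P + ab,
    whose weight w'(ab) w(P) is split by [mix] in exactly the ratio of those two. Cycles that avoid
    both v and ab agree term by term. *)
Lemma elimination_degree2 (f : {set {set V}} -> rat) :
  \sum_(C | cyc C) cycle_weight w C * f C =
  w [set v; a] * w [set v; b] * w [set a; b] * f (triangle v a b) +
  \sum_(C | cyc C) cycle_weight w' C * mix v a b r f C.
Proof.
rewrite (bigID (fun C : {set {set V}} => [exists E in C, v \in E])) /= sum_cyc_through.
rewrite [X in _ = _ + X](bigID (fun C : {set {set V}} => [exists E in C, v \in E])) /=.
rewrite [X in _ = _ + (X + _)]big1 ?add0r; last first.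
  move=> C /andP[cC /existsP[E /andP[EC vE]]].
  have [x [y [s [us ls xy eC]]]] := cyc_through cC EC vE.
  have xv : x != v by case/andP: us; rewrite inE negb_or eq_sym => /andP[].
  have xC : [set v; x] \in C by rewrite eC !inE eqxx orbT.
  by rewrite (cycle_weight0 xC (w'_v xv)) mul0r.
have vP1 := vpath1 va vb ab.
rewrite (bigD1 [set [set a; b]]) //= -addrA; congr (_ + _).
  rewrite /cycle_weight big_set1; congr (_ * f _).
  by rewrite /triangle setUA.
rewrite [X in _ + X = _](bigID (fun C : {set {set V}} => [set a; b] \in C)) /= sum_cyc_edge.
rewrite [X in _ = X](bigID (fun C : {set {set V}} => [set a; b] \in C)) /= sum_cyc_edge.
rewrite addrA; congr (_ + _); last first.
  apply: eq_bigr => C /andP[/andP[_ /existsPn nv] abC]; rewrite /mix (negPf abC).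
  congr (_ * _); apply: eq_cycle_weight => E EC; rewrite w'_eq //.
    by have := nv E; rewrite EC.
  by apply: contraNneq abC => <-.
have -> : \sum_(P | vpath v a b P && (P != [set [set a; b]]))
    w [set v; a] * w [set v; b] * cycle_weight w P * f ([set v; a] |: ([set v; b] |: P)) =
  \sum_(P | vpath v a b P && ([set a; b] \notin P))
    w [set v; a] * w [set v; b] * cycle_weight w P * f ([set v; a] |: ([set v; b] |: P)).
  apply: eq_bigl => P; case vP: (vpath v a b P) => //=; congr negb.
  apply/eqP/idP => [->|h]; [by rewrite set11 | exact (vpath_edge vP h)].
rewrite -big_split /=; apply: eq_bigr => P /andP[vP abP].
have -> : cycle_weight w' P = cycle_weight w P.
  apply: eq_cycle_weight => E EP; rewrite w'_eq //; first exact: (vpath_avoid vP EP).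
  by apply: contraNneq abP => <-.
rewrite /mix setU11 detour_id // mulrDr !mulrA [w' _ * _ * r]mulrAC [w' _ * r]mulrC r_eq.
congr (_ + _); rewrite [w' _ * _ * (1 - r)]mulrAC mulrBr mulr1 [w' _ * r]mulrC r_eq.
by rewrite w'_ab addrK.
Qed.
End Degree2.

(** Covers attempts at a vertex without exactly two neighbours: no cycle of positive weight is
    affected, so [mix] never acts and the triangle term is zero. *)
Lemma elimination_trivial (v a b : V) (w w' : {set V} -> rat) r f :
  (forall C, cyc C -> cycle_weight w' C = cycle_weight w C) ->
  w [set v; a] * w [set v; b] * w [set a; b] = 0 ->
  (forall C, cyc C -> cycle_weight w' C != 0 -> [set a; b] \notin C) ->
  \sum_(C | cyc C) cycle_weight w C * f C =
  w [set v; a] * w [set v; b] * w [set a; b] * f (triangle v a b) +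
  \sum_(C | cyc C) cycle_weight w' C * mix v a b r f C.
Proof.
move=> ww -> abC; rewrite mul0r add0r; apply: eq_bigr => C cC; rewrite -ww //.
have [->|h] := eqVneq (cycle_weight w' C) 0; first by rewrite !mul0r.
by rewrite /mix (negPf (abC _ cC h)).
Qed.

End Elimination.

(** * Elimination order on rational weights *)

Section Weights.
Variable V : finType.
Implicit Types (x y v a b : V) (C P : {set {set V}}) (f : pred V).

(* Numerators and denominators, not reduced. *)
Definition weights := {ffun {set V} -> nat * nat}.
Implicit Types w : weights.

Definition value w (E : {set V}) : rat := ((w E).1%:R / (w E).2%:R)%R.

(** Since [[set x; x]] is [[set x]], weight zero on singletons makes [adjacent] irreflexive and
    gives triangle weight zero to every record in which v serves as padding. *)
Definition wellformed w := (forall E, 0 < (w E).2) /\ (forall x, w [set x] = (0, 1)).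

Definition adjacent w : rel V := fun x y => (w [set x; y]).1 != 0.

(** The state of the row scan of the machine: the number of neighbours met so far and the last two
    of them. *)
Definition scan_step f (t : nat * V * V) x : nat * V * V :=
  if f x then (t.1.1.+1, x, t.1.2) else t.

Definition scan f v (s : seq V) : nat * V * V := foldl (scan_step f) (0, v, v) s.

(* The neighbours of v, padded with v; (v, v) if there are more than two. *)
Definition select w v : V * V :=
  let t := scan (adjacent w v) v (enum V) in
  if 2 < t.1.1 then (v, v) else (t.1.2, t.2).

(** The triangle weighs tnum / tden, the detour is taken with probability lnum / lden, and lden /
    tden is the new weight of ab. As lnum / tden is w(va) w(vb), four numbers sufficient for the
    undo also give the update. *)
Record record := Record {
  rv : V; ra : V; rb : V; tnum : nat; tden : nat; lnum : nat; lden : nat }.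

Definition record_of w v : record :=
  let a := (select w v).1 in let b := (select w v).2 in
  let alpha := w [set v; a] in let beta := w [set v; b] in let gamma := w [set a; b] in
  locked (Record v a b (alpha.1 * beta.1 * gamma.1) (alpha.2 * beta.2 * gamma.2)
    (alpha.1 * beta.1 * gamma.2) (gamma.1 * alpha.2 * beta.2 + alpha.1 * beta.1 * gamma.2)).

(** The edges at v are tested first: when v pads a missing neighbour, [[set a; b]] is itself one of
    them, and it must be deleted. *)
Definition eliminate w v : weights :=
  let r := record_of w v in
  [ffun E => if (E == [set v; ra r]) || (E == [set v; rb r]) then (0, 1)
             else if E == [set ra r; rb r] then (lden r, tden r) else w E].

Lemma eliminateE w v (E : {set V}) : eliminate w v E =
  let: (a, b) := select w v in
  if (E == [set v; a]) || (E == [set v; b]) then (0, 1)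
  else if E == [set a; b] then (lden (record_of w v), tden (record_of w v)) else w E.
Proof. by rewrite ffunE /record_of -lock /=; case: (select w v). Qed.

Lemma scan_filter f v s :
  scan f v s = foldl (fun t x => (t.1.1.+1, x, t.1.2)) (0, v, v) (filter f s).
Proof.
rewrite /scan; elim: s (0, v, v) => //= x s IH t; rewrite IH /scan_step.
by case: ifP.
Qed.

Variant select_spec w v : V * V -> Prop :=
  | SelectNone of
      (forall x, ~~ adjacent w v x) \/ 2 < #|[set x | adjacent w v x]| :
      select_spec w v (v, v)
  | SelectOne a of a != v & (forall x, adjacent w v x = (x == a)) :
      select_spec w v (a, v)
  | SelectTwo a b of a != b & a != v & b != v &
      (forall x, adjacent w v x = (x == a) || (x == b)) :
      select_spec w v (a, b).

Lemma selectP w v : wellformed w -> select_spec w v (select w v).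
Proof.
move=> [_ w1]; rewrite /select scan_filter.
have vv : ~~ adjacent w v v by rewrite /adjacent setUid w1.
have mem x : (x \in [seq x <- enum V | adjacent w v x]) = adjacent w v x.
  by rewrite mem_filter mem_enum andbT.
have card : #|[set x | adjacent w v x]| = size [seq x <- enum V | adjacent w v x].
  by rewrite cardE -filter_predI; congr size; apply: eq_filter => x; rewrite /= inE andbT.
have := filter_uniq (adjacent w v) (enum_uniq V).
have neq x : adjacent w v x -> x != v by apply: contraTneq => ->.
case: [seq _ <- _ | _] mem card => [|a [|b [|c q]]] mem card uq /=.
- by apply: SelectNone; left=> x; rewrite -mem.
- apply: SelectOne => [|x]; first by apply: neq; rewrite -mem inE.
  by rewrite -mem inE.
- apply: SelectTwo => [|||x].
  + by move: uq; rewrite /= inE eq_sym andbT.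
  + by apply: neq; rewrite -mem !inE eqxx orbT.
  + by apply: neq; rewrite -mem !inE eqxx.
  + by rewrite -mem !inE orbC.
- suff sz t : t.1.1 <= (foldl (fun t x => (t.1.1.+1, x, t.1.2)) t q).1.1.
    have -> : 2 < (foldl (fun t x => (t.1.1.+1, x, t.1.2)) (3, c, b) q).1.1 by exact: sz (3, c, b).
    by apply: SelectNone; right; rewrite card.
  by elim: q t {mem card uq} => //= x q IH t; apply: leq_trans (IH _).
Qed.

Lemma adjacent_sym w : symmetric (adjacent w).
Proof. by move=> x y; rewrite /adjacent setUC. Qed.

Lemma adjacent_irr w : wellformed w -> irreflexive (adjacent w).
Proof. by move=> [_ w1] x; rewrite /adjacent setUid w1. Qed.

Lemma eliminate_none w v : wellformed w -> select w v = (v, v) -> eliminate w v = w.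
Proof.
move=> [_ w1] sel; apply/ffunP => E; rewrite eliminateE sel setUid orbb.
by case: eqP => // ->; rewrite w1.
Qed.

Lemma tden_gt0 w v : wellformed w -> 0 < tden (record_of w v).
Proof.
by move=> [w0 _]; rewrite /record_of -lock /= !muln_gt0 !w0.
Qed.

Lemma wellformed_eliminate w v : wellformed w -> wellformed (eliminate w v).
Proof.
move=> pw; have [w0 w1] := pw.
split=> [E|x]; rewrite eliminateE.
  case: (select w v) => a b; case: ifP => // _; case: ifP => // _.
  exact: tden_gt0.
case: (selectP v pw) => [_|a av _|a b ab _ _ _].
- by rewrite setUid orbb; case: ifP => // ->; rewrite w1.
- rewrite -[[set x]]setUid !set2_eq; case: ifP => // nv; case: ifP => [xab|_].
    by move: nv; rewrite orbC in xab; rewrite xab.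
  by rewrite setUid w1.
- rewrite -[[set x]]setUid !set2_eq; case: ifP => // nv; case: ifP => [xab|_].
    by case/orP: xab ab => /andP[/eqP -> /eqP ->]; rewrite eqxx.
  by rewrite setUid w1.
Qed.

(** * Progress of the elimination rounds *)

Definition active w : {set V} := [set x | [exists y, adjacent w x y]].

Lemma adjacent_eliminate w v x y : wellformed w -> adjacent (eliminate w v) x y ->
  adjacent w x y \/
  exists a b, [/\ select w v = (a, b), a != v, b != v & [set x; y] = [set a; b]]
      /\ [/\ a != b, adjacent w v a & adjacent w v b].
Proof.
move=> pw; rewrite /adjacent eliminateE.
case: (selectP v pw) => [_|c cv _|c d cd cv dv nb].
- by case: ifP => //= /negbT; rewrite orbb => /negPf -> xy; left.
- case: ifP => //= nv; case: ([set x; y] =P _) => [e|_ xy]; last by left.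
  by rewrite e [[set c; v]]setUC eqxx in nv.
- case: ifP => //= nv; case: ([set x; y] =P _) => [e _|_ xy]; last by left.
  right; exists c, d; do !split=> //; first by rewrite -/(adjacent w v c) nb eqxx.
  by rewrite -/(adjacent w v d) nb eqxx orbT.
Qed.

Lemma active_mem w x y : adjacent w x y -> (x \in active w) && (y \in active w).
Proof.
move=> xy; rewrite !inE; apply/andP; split; apply/existsP; first by exists y.
by exists x; rewrite adjacent_sym.
Qed.

Lemma active_eliminate w v : wellformed w -> active (eliminate w v) \subset active w.
Proof.
move=> pw; apply/subsetP => x; rewrite inE => /existsP[y /(adjacent_eliminate pw)].
case=> [/active_mem/andP[] //|[a [b [[_ _ _ /eqP]]]]].
rewrite set2_eq => e [_ /active_mem /andP[_ h1] /active_mem /andP[_ h2]].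
by case/orP: e => /andP[/eqP ->].
Qed.

Lemma eliminate_isolated w v : wellformed w -> select w v != (v, v) ->
  v \in active w /\ v \notin active (eliminate w v).
Proof.
move=> pw sel; have eE x := eliminateE w v [set v; x].
case: (selectP v pw) sel eE => [|a av nb|a b ab av bv nb] => //; rewrite ?eqxx // => _ eE.
- split; first by rewrite inE; apply/existsP; exists a; rewrite nb eqxx.
  rewrite inE; apply/existsPn => x; rewrite /adjacent eE.
  rewrite !set2_eq !eqxx ![v == a]eq_sym (negPf av) /= orbF.
  have := nb x; rewrite /adjacent; case: (x =P a) => //= _ /negbT/negPn/eqP e.
  by case: ifP => //= _; rewrite e eqxx.
- split; first by rewrite inE; apply/existsP; exists a; rewrite nb eqxx.
  rewrite inE; apply/existsPn => x; rewrite /adjacent eE.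
  rewrite !set2_eq !eqxx ![v == _]eq_sym (negPf av) (negPf bv) /= !orbF.
  have := nb x; rewrite /adjacent; case: ifP => //= _ /negbT/negPn/eqP ->.
  by rewrite eqxx.
Qed.

(** The only possible new edge ab joins two neighbours of v, and v becomes isolated, so the new
    graph lies in the contraction of v into a. Without a new edge it is a subgraph of the old
    one. *)
Lemma tw2_eliminate w v : wellformed w -> tw2 (adjacent w) -> tw2 (adjacent (eliminate w v)).
Proof.
move=> pw tw.
have := eliminate_isolated pw; have := adjacent_eliminate pw.
have := eliminate_none pw.
move=> /(_ v) e0 /(_ v) e1 /(_ v) e2.
case: (eqVneq (select w v) (v, v)) => [/e0 -> //|/e2[_ vn]].
have [a0 [b0 es]] : exists a0 b0, select w v = (a0, b0) by case: (select w v) => a b; exists a, b.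
have [va|va] := boolP (adjacent w v a0 && (a0 != v)).
  case/andP: va => va a0v.
  apply: (tw2_contract (g := adjacent w) (v := v) (a := a0)) tw => //; first exact: adjacent_sym.
  move=> x y xy; have /andP[xa ya] := active_mem xy.
  split; [by apply: contraNneq vn => e; rewrite -{1}e|by apply: contraNneq vn => e; rewrite -{1}e|].
  case: (e1 _ _ xy) => [->//|[a [b [[]]]]]; rewrite es => -[<- <-] _ _ /eqP.
  rewrite set2_eq => /orP[] /andP[/eqP -> /eqP ->] [_ h1 h2].
    by rewrite eqxx h2 orbT.
  by rewrite eqxx [adjacent w b0 v]adjacent_sym h2 !orbT.
apply: tw2_sub tw => x y /e1[//|[a [b [[]]]]]; rewrite es => -[<- <-] av _ _ [_ h1 h2].
by rewrite h1 av in va.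
Qed.

Definition nactive w := #|active w|.

Lemma nactive_eliminate w v : wellformed w -> nactive (eliminate w v) <= nactive w.
Proof. by move=> pw; apply: subset_leq_card; exact: active_eliminate. Qed.

Lemma wellformed_foldl w s : wellformed w -> wellformed (foldl eliminate w s).
Proof. by elim: s w => //= v s IH w pw; apply: IH; exact: wellformed_eliminate. Qed.

Lemma tw2_foldl w s : wellformed w -> tw2 (adjacent w) -> tw2 (adjacent (foldl eliminate w s)).
Proof.
elim: s w => //= v s IH w pw tw; apply: IH; [exact: wellformed_eliminate | exact: tw2_eliminate].
Qed.

Lemma nactive_foldl w s : wellformed w -> nactive (foldl eliminate w s) <= nactive w.
Proof.
elim: s w => //= v s IH w pw; apply: leq_trans (nactive_eliminate v pw).
by apply: IH; exact: wellformed_eliminate.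
Qed.

(* An elimination that changes the weights isolates its vertex for good, hence lowers nactive. *)
Lemma round_stuck w s : wellformed w -> nactive w <= nactive (foldl eliminate w s) ->
  {in s, forall v, select w v = (v, v)}.
Proof.
elim: s w => //= v s IH w pw le.
have sv : select w v = (v, v).
  apply/eqP/negPn/negP => /(eliminate_isolated pw)[va vn].
  have lt : nactive (eliminate w v) < nactive w.
    apply: proper_card; apply/properP; split; first exact: active_eliminate.
    by exists v.
  have := leq_trans le (nactive_foldl s (wellformed_eliminate v pw)).
  by rewrite leqNgt lt.
rewrite eliminate_none // in le.
by move=> x; rewrite inE => /predU1P[-> //|]; apply: IH.
Qed.

(** A round without progress has met no vertex of degree 1 or 2. As degrees at most 2 occur among
    non-isolated vertices by [tw2_low_degree], no edge is then left and the count is 0, where the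
    truncated predecessor is harmless. *)
Lemma nactive_round w : wellformed w -> tw2 (adjacent w) ->
  nactive (foldl eliminate w (enum V)) <= (nactive w).-1.
Proof.
move=> pw tw; have [lt|le] := ltnP (nactive (foldl eliminate w (enum V))) (nactive w).
  by rewrite -ltnS (leq_trans lt) // leqSpred.
have st := round_stuck pw le.
suff -> : nactive (foldl eliminate w (enum V)) = 0 by [].
apply/eqP; rewrite -leqn0; apply: leq_trans (nactive_foldl _ pw) _; rewrite leqn0.
rewrite cards_eq0; apply/set0Pn => -[x0]; rewrite inE => /existsP[y0 xy0].
have [x [[y xy] deg]] : exists x, (exists y, adjacent w x y) /\ #|[set y | adjacent w x y]| <= 2.
  apply: tw2_low_degree => //; [exact: adjacent_sym | exact: adjacent_irr|].
  by exists x0, y0.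
have := st x; rewrite mem_enum => /(_ isT).
case: (selectP x pw) => [[/(_ y)|]|a av _ [e]|a b _ av _ _ [e _]].
- by rewrite xy.
- by rewrite ltnNge deg.
- by rewrite e eqxx in av.
- by rewrite e eqxx in av.
Qed.

Lemma nactive_rounds w k : wellformed w -> tw2 (adjacent w) ->
  nactive (foldl eliminate w (flatten (nseq k (enum V)))) <= nactive w - k.
Proof.
elim: k w => [|k IH] w pw tw; first by rewrite subn0.
rewrite /= foldl_cat; apply: leq_trans (IH _ _ _) _; [exact: wellformed_foldl | exact: tw2_foldl|].
by apply: leq_trans (leq_sub2r k (nactive_round pw tw)) _; rewrite -subn1 -subnDA.
Qed.

Lemma eliminate_all w : wellformed w -> tw2 (adjacent w) -> forall x y,
  ~~ adjacent (foldl eliminate w (flatten (nseq #|V| (enum V)))) x y.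
Proof.
move=> pw tw x y; apply/negP => /active_mem /andP[h _].
have := nactive_rounds #|V| pw tw.
have -> : nactive w - #|V| = 0 by apply/eqP; rewrite subn_eq0 max_card.
by rewrite leqn0 cards_eq0 => /eqP e; rewrite e inE in h.
Qed.

End Weights.

(** * Law of the sampled cycle and size of the fractions *)

Section Law.
Variable V : finType.
Implicit Types (x y v a b : V) (C P : {set {set V}}) (w : weights V).
Local Open Scope ring_scope.

Lemma value_adjacent w x y : value w [set x; y] != 0 -> adjacent w x y.
Proof.
by rewrite /value /adjacent; apply: contraNN => /eqP ->; rewrite mul0r.
Qed.

Lemma value_ge0 w E : 0 <= value w E.
Proof. by rewrite /value divr_ge0. Qed.

Lemma value_cycle_ge0 w C : 0 <= cycle_weight (value w) C.
Proof. by apply: prodr_ge0 => E _; exact: value_ge0. Qed.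

Lemma bias_le (p q : nat) : (p <= q)%N -> bias p q = p%:R / q%:R.
Proof.
move=> pq; rewrite /bias; apply: min_r; case: q pq => [|q pq]; first by rewrite invr0 mulr0.
by rewrite ler_pdivrMr ?ltr0Sn // mul1r ler_nat.
Qed.

(** For a record with a = b = v the pair ab is a singleton; as no cycle contains it, [mix] is the
    identity on such records. *)
Lemma cyc_not_singleton C x : cyc C -> [set x] \notin C.
Proof.
move=> cC; apply/negP => xC.
have [y [z [s [us ls yz eC]]]] := cyc_through cC xC (set11 x).
have : [set x; x] \in C by rewrite setUid.
rewrite eC !inE !set2_eq !eqxx !andTb !andbT !orbb.
case/andP: us => xs _; have xE t : t \in y :: s -> (x == t) = false.
  by move=> ts; apply: contraNF xs => /eqP ->.
rewrite -ls !xE ?mem_last ?mem_head //= => h.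
by rewrite (path_edges_mem h) ?set21 in xs.
Qed.

Definition mix_record (r : record V) := mix (rv r) (ra r) (rb r) (bias (lnum r) (lden r)).

Lemma elimination_sum w v (f : {set {set V}} -> rat) : wellformed w ->
  let r := record_of w v in
  \sum_(C | cyc C) cycle_weight (value w) C * f C =
  (tnum r)%:R / (tden r)%:R * f (triangle (rv r) (ra r) (rb r)) +
  \sum_(C | cyc C) cycle_weight (value (eliminate w v)) C * mix_record r f C.
Proof.
move=> pw r; have [w0 w1] := pw.
have E : (tnum r)%:R / (tden r)%:R = value w [set v; ra r] * value w [set v; rb r] *
     value w [set ra r; rb r] :> rat.
  rewrite /r /record_of -lock /value /= !natrM; field.
  by rewrite !pnatr_eq0 -!lt0n !w0.
have Eab : value w [set v; ra r] * value w [set v; rb r] = (lnum r)%:R / (tden r)%:R.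
  rewrite /r /record_of -lock /value /= !natrM; field.
  by rewrite !pnatr_eq0 -!lt0n !w0.
have Es : (lden r)%:R / (tden r)%:R = value w [set ra r; rb r] + (lnum r)%:R / (tden r)%:R.
  rewrite /r /record_of -lock /value /= natrD !natrM; field.
  by rewrite !pnatr_eq0 -!lt0n !w0.
have lr : (lnum r <= lden r)%N by rewrite /r /record_of -lock; exact: leq_addl.
have rabE : (ra r, rb r) = select w v by rewrite /r /record_of -lock /=; case: (select w v).
have eE E0 : eliminate w v E0 = if (E0 == [set v; ra r]) || (E0 == [set v; rb r]) then (0, 1)%N
             else if E0 == [set ra r; rb r] then (lden r, tden r) else w E0.
  by rewrite eliminateE -rabE.
have td0 : (0 < tden r)%N by exact: tden_gt0.
(* When lden = 0 the bias is 0 / 0 = 0; the identity required of it still holds because lnum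
   vanishes too. *)
have ld_eq0 : lden r = 0%N -> lnum r = 0%N by lia.
have rvE : rv r = v by rewrite /r /record_of -lock.
clearbody r.
rewrite E /mix_record rvE; move: rabE (eliminate_none (v := v) pw).
set a := ra r in E Eab Es eE *; set b := rb r in E Eab Es eE *.
case: (selectP v pw) => [_ [ea eb] /(_ erefl) en|c cv nb [ea eb] _|c d cd cv dv nb [ea eb] _].
- apply: elimination_trivial => [C _||C cC _].
  + by rewrite en.
  + by rewrite ea eb setUid /value w1 !mul0r.
  + by rewrite ea eb setUid; exact: cyc_not_singleton.
- have w'v x : value (eliminate w v) [set v; x] = 0.
    rewrite /value eE ea eb; case: ifP => [_|]; first by rewrite mul0r.
    move=> h; have xc : x != c by apply: contraFneq h => ->; rewrite eqxx.
    rewrite [[set c; v]]setUC; have /norP[/negPf -> _] := negbT h.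
    by have := nb x; rewrite (negPf xc) /adjacent => /negbFE /eqP ->; rewrite mul0r.
  apply: elimination_trivial => [C cC||C cC].
  (* A cycle through v has two distinct edges at v, and only c is adjacent to v; hence its weight is
     zero both before and after the deletion. *)
  + have [/existsP[F /andP[FC vF]]|/existsPn nF] := boolP [exists F in C, v \in F].
      have [x [y [s [us ls xy eC]]]] := cyc_through cC FC vF.
      have xC : [set v; x] \in C by rewrite eC !inE eqxx orbT.
      have yC : [set v; y] \in C by rewrite eC !inE eqxx.
      rewrite (cycle_weight0 xC (w'v x)).
      have [ex|nx] := eqVneq x c; last first.
        by rewrite (@cycle_weight0 _ _ _ _ xC) //; apply/eqP/negPn/negP => /value_adjacent; rewrite nb (negPf nx).
      rewrite (@cycle_weight0 _ _ _ _ yC) //; apply/eqP/negPn/negP => /value_adjacent.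
      by rewrite nb -ex eq_sym (negPf xy).
    apply: eq_cycle_weight => F FC; have := nF F; rewrite FC /= => vF.
    have nn x : (F == [set v; x]) = false by apply: contraNF vF => /eqP ->; rewrite set21.
    by rewrite /value eE ea eb !nn /= [[set c; v]]setUC nn.
  + by rewrite eb setUid {2}/value w1 !(mul0r, mulr0).
  + move=> h; apply: contraNN h => h; apply/eqP; apply: cycle_weight0 h _.
    by rewrite ea eb setUC.
- apply: elimination_degree2.
  + by rewrite ea eq_sym.
  + by rewrite eb eq_sym.
  + by rewrite ea eb.
  + by move=> x xv /value_adjacent; rewrite nb ea eb => /orP[] /eqP; [left|right].
  + move=> x xv; rewrite /value eE ea eb; case: ifP => [_|]; first by rewrite mul0r.
    rewrite !set2_eq !eqxx ![v == _]eq_sym (negPf cv) (negPf dv) /= !orbF => h.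
    by have := nb x; rewrite h /adjacent => /negbFE /eqP ->; rewrite mul0r.
  + rewrite Eab -Es /value eE ea eb !set2_eq [c == v](negPf cv) [d == v](negPf dv) !andbF /=.
    by rewrite !eqxx.
  + move=> F vF /negPf nF; rewrite /value eE nF.
    have nn x : (F == [set v; x]) = false by apply: contraNF vF => /eqP ->; rewrite set21.
    by rewrite !nn.
  + rewrite Eab bias_le // /value eE ea eb !set2_eq [c == v](negPf cv) [d == v](negPf dv) !andbF /=.
    rewrite !eqxx /=; have [/[dup] e /ld_eq0 ->|n0] := eqVneq (lden r) 0%N.
      by rewrite !mul0r.
    by field; rewrite !pnatr_eq0 n0 -lt0n td0.
Qed.

Fixpoint trace w (s : seq V) : seq (record V) :=
  if s is v :: s' then record_of w v :: trace (eliminate w v) s' else [::].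

(* Sum of the fractions tnum / tden, not reduced. *)
Definition total_step (r : record V) (z : nat * nat) : nat * nat :=
  (z.1 * tden r + tnum r * z.2, z.2 * tden r)%N.

Definition fraction_sum (rs : seq (record V)) : nat * nat := foldr total_step (0, 1)%N rs.

(** Undoing one record, as an operator on f. The bias is the share of the triangle in the partial
    sum; both fractions have denominator z.2 * tden, which cancels. *)
Definition record_kernel (r : record V) (z : nat * nat) (f : {set {set V}} -> rat) C : rat :=
  let p := bias (tnum r * z.2) (total_step r z).1 in
  p * f (triangle (rv r) (ra r) (rb r)) + (1 - p) * mix_record r f C.

(** The expectation of f over the output. The first record is undone last, so its kernel is the
    first to be applied to f. The chain starts from the empty set. *)
Fixpoint law (rs : seq (record V)) (f : {set {set V}} -> rat) : rat :=
  if rs is r :: rs' then law rs' (record_kernel r (fraction_sum rs') f) else f set0.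

Definition total_value (rs : seq (record V)) : rat := (fraction_sum rs).1%:R / (fraction_sum rs).2%:R.

Lemma mix_const v a b (r k : rat) f C : (forall C, f C = k) -> mix v a b r f C = k.
Proof. by move=> fk; rewrite /mix !fk; case: ifP => // _; rewrite -mulrDl subrKC mul1r. Qed.

Lemma law_const rs f k : (forall C, f C = k) -> law rs f = k.
Proof.
elim: rs f => [|r rs IH] f fk /=; first exact: fk.
apply: IH => C; rewrite /record_kernel fk /mix_record (mix_const _ _ _ _ _ fk).
by rewrite -mulrDl subrKC mul1r.
Qed.

Lemma total_gt0 w s : wellformed w -> (0 < (fraction_sum (trace w s)).2)%N.
Proof.
elim: s w => //= v s IH w pw; rewrite muln_gt0 IH ?tden_gt0 //.
exact: wellformed_eliminate.
Qed.

Lemma total_value_cons (r : record V) rs : (0 < tden r)%N -> (0 < (fraction_sum rs).2)%N ->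
  total_value (r :: rs) = (tnum r)%:R / (tden r)%:R + total_value rs.
Proof.
rewrite /total_value /=; case: (fraction_sum _) => z1 z2 /= h1 h2.
by rewrite natrD !natrM; field; rewrite !pnatr_eq0 -!lt0n h1 h2.
Qed.

Definition exhausted w s := forall x y, ~~ adjacent (foldl (@eliminate V) w s) x y.

Lemma exhausted_weight w C : exhausted w [::] -> cyc C -> cycle_weight (value w) C = 0.
Proof.
move=> ew cC; have /cycP[x [s [_ _ eC]]] := cC.
have xC : [set last x s; x] \in C by rewrite eC setU11.
apply: cycle_weight0 xC _; apply/eqP/negPn/negP => /value_adjacent h.
by have := ew (last x s) x; rewrite /= h.
Qed.

Lemma total_correct w s : wellformed w -> exhausted w s ->
  total_value (trace w s) = \sum_(C | cyc C) cycle_weight (value w) C.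
Proof.
elim: s w => [|v s IH] w pw ew.
  by rewrite /total_value mul0r big1 // => C cC; exact: exhausted_weight.
rewrite total_value_cons ?tden_gt0 ?total_gt0 ?IH //; try exact: wellformed_eliminate.
have := elimination_sum v (fun=> 1) pw; rewrite /= mulr1.
under eq_bigr do rewrite mulr1.
under [X in _ = _ + X]eq_bigr do rewrite /mix_record (@mix_const _ _ _ _ 1) // mulr1.
by [].
Qed.

(** Stated as a product because the total of a suffix of the trace may be zero. With Z = tau + Z',
    where tau is the weight of the first triangle, the triangle is taken with probability tau / Z
    and the rest is kept with probability Z' / Z, which are the proportions of the two terms in
    [elimination_sum]. *)
Lemma law_correct w s f : wellformed w -> exhausted w s ->
  total_value (trace w s) * law (trace w s) f =
  \sum_(C | cyc C) cycle_weight (value w) C * f C.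
Proof.
elim: s w f => [|v s IH] w f pw ew.
  by rewrite /total_value /= !mul0r big1 // => C cC; rewrite exhausted_weight // mul0r.
have pw' := wellformed_eliminate v pw; have ew' : exhausted (eliminate w v) s by [].
have Zsum := total_correct pw ew; have Zsum' := total_correct pw' ew'.
have Zc := total_value_cons (tden_gt0 v pw) (total_gt0 s pw').
(* Weights are nonnegative, so a zero total makes each of them zero. *)
have vanish (g : {set {set V}} -> rat) w0 : \sum_(C | cyc C) cycle_weight (value w0) C = 0 ->
    \sum_(C | cyc C) cycle_weight (value w0) C * g C = 0.
  move=> /eqP; rewrite psumr_eq0 => [/allP h|C _]; last exact: value_cycle_ge0.
  apply: big1 => C cC; have := h C (mem_index_enum _); rewrite cC /= => /eqP ->.
  by rewrite mul0r.
have [Z0|Zn0] := eqVneq (total_value (trace w (v :: s))) 0.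
  by rewrite Z0 mul0r vanish // -Zsum.
have td0 := tden_gt0 v pw; rewrite (elimination_sum v f pw) /=.
rewrite /= in Zsum Zc Zn0; move: (record_of w v) td0 Zc Zn0 Zsum => r td0 Zc Zn0 Zsum.
set Z := total_value _ in Zsum Zc Zn0 *; set Z' := total_value _ in Zsum' Zc.
set tau := _ / _ in Zc *.
set p := bias (tnum r * (fraction_sum (trace (eliminate w v) s)).2)
   (total_step r (fraction_sum (trace (eliminate w v) s))).1.
have pE : p = tau / Z.
  rewrite /p bias_le; last by rewrite /total_step /= leq_addl.
  move: Zn0; rewrite /Z /total_value /= /tau.
  have := total_gt0 s pw'; move: td0.
  case: (fraction_sum _) => z1 z2 /= h1 h2; rewrite natrD !natrM.
  have h1' : (tden r)%:R != 0 :> rat by rewrite pnatr_eq0 -lt0n.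
  have h2' : z2%:R != 0 :> rat by rewrite pnatr_eq0 -lt0n.
  move=> h3; have h4 : z1%:R * (tden r)%:R + (tnum r)%:R * z2%:R != 0 :> rat.
    by apply: contraNneq h3 => ->; rewrite mul0r.
  by field; rewrite h1' h2' h4.
have p1E : 1 - p = Z' / Z by rewrite pE Zc; field; rewrite -Zc.
set S' := \sum_(C | _) _.
(* If the later records total zero, then p = 1: the state reached so far is discarded and
   [law_const] applies. Otherwise [IH] may be divided by Z'. *)
have [Z0|Z'n0] := eqVneq Z' 0.
  have p1 : p = 1 by move: p1E; rewrite Z0 mul0r => /eqP; rewrite subr_eq0 => /eqP.
  rewrite (@law_const _ _ (f (triangle (rv r) (ra r) (rb r)))); last first.
    by move=> C; rewrite /record_kernel -/p p1 subrr mul0r addr0 mul1r.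
  by rewrite /S' vanish -?Zsum' // addr0 Zc Z0 addr0.
have IHf := IH (eliminate w v) (record_kernel r (fraction_sum (trace (eliminate w v) s)) f) pw' ew'.
have -> : law (trace (eliminate w v) s)
    (record_kernel r (fraction_sum (trace (eliminate w v) s)) f) =
    (p * f (triangle (rv r) (ra r) (rb r)) * Z' + (1 - p) * S') / Z'.
  apply: (mulfI Z'n0); rewrite [Z' * law _ _]IHf mulrCA divff // mulr1 Zsum' /S' !mulr_sumr.
  rewrite -big_split /=; apply: eq_bigr => C _.
  rewrite /record_kernel -/p; ring.
rewrite p1E pE; field; by rewrite Zn0 Z'n0.
Qed.

End Law.

(** * Size of the unreduced fractions *)

Section Bounds.
Variable V : finType.
Implicit Types (v a b : V) (w : weights V).

(** A potential for the growth of the fractions. A pair without an edge holds 0 / 1 and contributes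
    the factor 1, so deleting an edge never increases the product. *)
Definition mass w := \prod_(E : {set V}) ((w E).1 + (w E).2).

Lemma mass_ge w (E : {set V}) : wellformed w -> (w E).1 + (w E).2 <= mass w.
Proof.
move=> [w0 _]; rewrite /mass (bigD1 E) //= leq_pmulr // prodn_gt0 // => F.
by rewrite addn_gt0 w0 orbT.
Qed.

Lemma mass_gt0 w : wellformed w -> 0 < mass w.
Proof. by move=> [w0 _]; rewrite /mass prodn_gt0 // => F; rewrite addn_gt0 w0 orbT. Qed.

(* The new edge is paid for by the three edges that it replaces. *)
Lemma mass_eliminate w v : wellformed w -> mass (eliminate w v) <= mass w.
Proof.
move=> pw; have [w0 _] := pw.
have eE E := eliminateE w v E.
have rE : (lden (record_of w v), tden (record_of w v)) =
  let: (a, b) := select w v in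
  ((w [set a; b]).1 * (w [set v; a]).2 * (w [set v; b]).2 +
   (w [set v; a]).1 * (w [set v; b]).1 * (w [set a; b]).2,
   (w [set v; a]).2 * (w [set v; b]).2 * (w [set a; b]).2).
  by rewrite /record_of -lock /=; case: (select w v).
have none := eliminate_none (v := v) pw.
case: (selectP v pw) none eE rE => [_ /(_ erefl) ->|a av _ _ eE _|a b ab av bv _ _ eE rE] //.
  apply: leq_prod => E _; rewrite eE; case: ifP => [_|].
    by rewrite addn_gt0 w0 orbT.
  by rewrite [[set a; v]]setUC => /negbT; rewrite negb_or => /andP[/negPf -> _].
have h1 : [set v; a] != [set v; b] by rewrite set2_eq eqxx (negPf ab) [v == b]eq_sym (negPf bv).
have h2 : [set v; a] != [set a; b] by rewrite set2_eq ![v == _]eq_sym (negPf av) (negPf bv).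
have h3 : [set v; b] != [set a; b] by rewrite set2_eq ![v == _]eq_sym (negPf av) (negPf bv).
case ea: (w [set v; a]) => [p q]; case eb: (w [set v; b]) => [r s].
case eab: (w [set a; b]) => [g h]; rewrite /mass.
rewrite (bigD1 [set v; a]) //= (bigD1 [set v; b]) 1?eq_sym //=.
rewrite (bigD1 [set a; b]) /=; last by rewrite ![[set a; b] == _]eq_sym h2 h3.
rewrite [X in _ <= X](bigD1 [set v; a]) //= [X in _ <= _ * X](bigD1 [set v; b]) 1?eq_sym //=.
rewrite [X in _ <= _ * (_ * X)](bigD1 [set a; b]) /=; last first.
  by rewrite ![[set a; b] == _]eq_sym h2 h3.
rewrite !eE !eqxx ![[set a; b] == _]eq_sym (negPf h2) (negPf h3) orbT rE /= !mul1n !mulnA.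
rewrite ea eb eab /=; apply: leq_mul; last first.
  apply: leq_prod => E /andP[/andP[/negPf n1 /negPf n2] /negPf n3].
  by rewrite eE n1 n2 n3.
(* The terms g q s, p r h and q s h on the left are three distinct monomials of the expansion of (p
   + q)(r + s)(g + h). *)
by nia.
Qed.

Lemma mass_foldl w s : wellformed w -> mass (foldl (@eliminate V) w s) <= mass w.
Proof.
elim: s w => //= v s IH w pw; apply: leq_trans (IH _ (wellformed_eliminate v pw)) _.
exact: mass_eliminate.
Qed.

Lemma record_bound w v M : wellformed w -> mass w <= M ->
  let r := record_of w v in
  [/\ tnum r + tden r <= M ^ 3, lnum r <= M ^ 3 & lden r <= 2 * M ^ 3].
Proof.
move=> pw wM; rewrite /record_of -lock /=; set a := (select w v).1; set b := (select w v).2.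
have := mass_ge [set v; a] pw; have := mass_ge [set v; b] pw; have := mass_ge [set a; b] pw.
case: (w [set a; b]) => g h; case: (w [set v; b]) => r s; case: (w [set v; a]) => p q /=.
move=> h1 h2 h3.
have ghM := leq_trans h1 wM; have rsM := leq_trans h2 wM; have pqM := leq_trans h3 wM.
have big : (p + q) * (r + s) * (g + h) <= M ^ 3.
  by rewrite !expnS expn0 muln1 mulnA !leq_mul.
by split; nia.
Qed.

(** Numerator plus denominator is submultiplicative under unreduced addition of fractions, and each
    record contributes a factor at most [M ^ 3]. *)
Lemma total_bound w s M : wellformed w -> mass w <= M -> 
  (fraction_sum (trace w s)).1 + (fraction_sum (trace w s)).2 <= (M ^ 3) ^ size s.
Proof.
elim: s w => [|v s IH] w pw wM //=.
have := IH _ (wellformed_eliminate v pw) (leq_trans (mass_eliminate v pw) wM).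
have [h _ _] := record_bound v pw wM; rewrite [_ ^ (size s).+1]expnS.
by case: (fraction_sum _) => z1 z2 /= hz; apply: (leq_trans _ (leq_mul h hz)); nia.
Qed.
End Bounds.

(** * Logic of the random access machine *)

Lemma nbits_le n k : 0 < k -> (nbits n <= k) = (n < 2 ^ k).
Proof.
move=> k0; rewrite /nbits; apply/idP/idP => [le|lt].
  by apply: leq_trans (@trunc_log_ltn 2 n isT) _; rewrite leq_exp2l.
case: n lt => [|n] lt; first by rewrite trunc_log0.
by rewrite -(@ltn_exp2l 2) // (leq_ltn_trans _ lt) // trunc_logP.
Qed.

Lemma ltn_nbits n : n < 2 ^ nbits n.
Proof. by rewrite -nbits_le. Qed.

Lemma leq_nbits m n : m <= n -> nbits m <= nbits n.
Proof. by move=> mn; rewrite nbits_le // (leq_ltn_trans mn) // ltn_nbits. Qed.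

Lemma nbits_add m n : nbits (m + n) <= nbits m + nbits n.
Proof.
rewrite nbits_le ?addn_gt0 // expnD; have := ltn_nbits m; have := ltn_nbits n.
set a := 2 ^ _; set b := 2 ^ _; move=> h1 h2.
have : 0 < m * n.+1 \/ m = 0 by lia.
nia.
Qed.

Lemma nbits_mul m n : nbits (m * n) <= nbits m + nbits n.
Proof.
rewrite nbits_le ?addn_gt0 // expnD; have := ltn_nbits m; have := ltn_nbits n.
by move=> h1 h2; exact: ltn_mul.
Qed.

Lemma nbits_id n : nbits n <= n.+1.
Proof. by rewrite nbits_le // (leq_trans (ltn_expl n (isT : 1 < 2))) // leq_exp2l. Qed.

Lemma nbits_eval_op o m n : nbits (eval_op o m n) <= nbits m + nbits n.
Proof.
case: o => /=; [exact: nbits_add | | exact: nbits_mul | ].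
  by apply: leq_trans (leq_addr _ _); apply: leq_nbits; exact: leq_subr.
by apply: leq_trans (leq_addr _ _); apply: leq_nbits; exact: leq_div.
Qed.

Definition bounded L (m : nat -> nat) := forall a, nbits (m a) <= L.

Lemma bounded_upd L m a v : bounded L m -> nbits v <= L -> bounded L (upd m a v).
Proof. by move=> bm bv b; rewrite /upd; case: ifP. Qed.

(** K depends on the expression alone: lengths at most add up under an operation, and a fetched
    value is again bounded by L. All later constants are uniform in n and in the input for this
    reason. *)
Lemma eval_bound e : exists K, forall L m, 0 < L -> bounded L m ->
  nbits (eval m e) <= K * L /\ cost m e <= K * L.
Proof.
elim: e => [k|e [K IH]|o e1 [K1 IH1] e2 [K2 IH2]].
- exists (nbits k) => L m L0 bm; rewrite /= addn0; split; exact: leq_pmulr.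
- exists K.+1 => L m L0 bm; have [h1 h2] := IH L m L0 bm; rewrite /= mulSn; split.
    exact: leq_trans (bm _) (leq_addr _ _).
  exact: leq_add (bm _) h2.
- exists (2 * (K1 + K2)) => L m L0 bm.
  have [h1 h2] := IH1 L m L0 bm; have [h3 h4] := IH2 L m L0 bm.
  have h := nbits_eval_op o (eval m e1) (eval m e2).
  by rewrite /=; split; nia.
Qed.

Inductive reach : config -> config -> Prop :=
  | reach_refl g : reach g g
  | reach_step g g' g'' : step g = [:: (1%R, g')] -> reach g' g'' -> reach g g''.

Lemma reach_trans g1 g2 g3 : reach g1 g2 -> reach g2 g3 -> reach g1 g3.
Proof. by elim=> // g g' g'' e _ IH /IH; apply: reach_step. Qed.

(* The machine halts on every branch, even on those of probability zero. *)
Definition outcome (g : config) (T : nat) (mu : seq nat -> rat) : Prop :=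
  exists N0, forall N, N0 <= N ->
    all (fun b => halted b.2 && (clock b.2.2 <= T)) (run N g) /\
    forall y, (\sum_(b <- run N g | halted b.2 && (out b.2.2 == y)) b.1 = mu y)%R.

Lemma outcome_halt s T mu : clock s <= T -> (forall y, mu y = (out s == y)%:R%R) ->
  outcome ([::], s) T mu.
Proof.
move=> sT muE; exists 0 => N _.
have -> : run N ([::], s) = [:: (1%R, ([::], s))].
  by elim: N => //= N IH; case: s sT muE IH => m i o t _ _ /= ->; rewrite /= mulr1.
rewrite /= sT; split=> // y; rewrite muE big_cons big_nil /= /halted /=.
by case: eqP => _; rewrite ?addr0.
Qed.

Lemma outcome_step g g' T mu : step g = [:: (1%R, g')] -> outcome g' T mu -> outcome g T mu.
Proof.
move=> e [N0 h]; exists N0.+1 => -[//|N] /h[h1 h2]; rewrite /= e /= cats0; split.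
  by rewrite all_map.
by move=> y; rewrite big_map /= -h2; apply: eq_bigr => d _; rewrite mul1r.
Qed.

Lemma outcome_reach g g' T mu : reach g g' -> outcome g' T mu -> outcome g T mu.
Proof. by elim=> // g1 g2 g3 e _ IH /IH; apply: outcome_step. Qed.

Lemma outcome_weaken g T T' mu mu' : T <= T' -> mu =1 mu' ->
  outcome g T mu -> outcome g T' mu'.
Proof.
move=> TT mm [N0 h]; exists N0 => N /h[h1 h2]; split; last by move=> y; rewrite h2.
by apply: sub_all h1 => b /andP[-> /leq_trans ->].
Qed.

Lemma outcome_toss a p q k m i o t T mu1 mu0 :
  let t' := t + (cost m a + cost m p + cost m q).+1 in
  let r := bias (eval m p) (eval m q) in
  outcome (k, State (upd m (eval m a) 1) i o t') T mu1 ->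
  outcome (k, State (upd m (eval m a) 0) i o t') T mu0 ->
  outcome (Toss a p q :: k, State m i o t) T (fun y => r * mu1 y + (1 - r) * mu0 y)%R.
Proof.
move=> t' r [N1 h1] [N0 h0]; exists (maxn N1 N0).+1 => -[//|N]; rewrite ltnS geq_max.
move=> /andP[/h1[a1 s1] /h0[a0 s0]]; split.
  by rewrite /= cats0 all_cat !all_map; apply/andP.
move=> y; rewrite /= cats0 big_cat !big_map /=; congr (_ + _)%R.
  by rewrite -s1 mulr_sumr.
by rewrite -s0 mulr_sumr.
Qed.

Definition data := ((nat -> nat) * seq nat * seq nat)%type.

Definition at_time (x : data) (t : nat) : state := State x.1.1 x.1.2 x.2 t.

(** * Time-bounded rules for straight-line code and loops *)

Fixpoint straight (c : cmd) : bool :=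
  match c with
  | Toss _ _ _ | While _ _ => false
  | Seq c1 c2 | If _ c1 c2 => straight c1 && straight c2
  | _ => true
  end.

Fixpoint exec (c : cmd) (x : data) : data :=
  let: (m, i, o) := x in
  match c with
  | Store a e => (upd m (eval m a) (eval m e), i, o)
  | Read a => (upd m (eval m a) (head 0 i), behead i, o)
  | Write e => (m, i, rcons o (eval m e))
  | Seq c1 c2 => exec c2 (exec c1 x)
  | If e c1 c2 => if eval m e != 0 then exec c1 x else exec c2 x
  | _ => x
  end.

Definition data_bounded L (x : data) := bounded L x.1.1 /\ forall v, v \in x.1.2 -> nbits v <= L.

Lemma data_bounded_le L L' x : L <= L' -> data_bounded L x -> data_bounded L' x.
Proof.
by move=> LL [h1 h2]; split=> [a|v /h2 h]; [exact: leq_trans (h1 a) LL | exact: leq_trans h LL].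
Qed.

Lemma exec_bound c : straight c -> exists K, forall L x t k, 0 < L -> data_bounded L x ->
  exists t', [/\ reach (c :: k, at_time x t) (k, at_time (exec c x) t'),
                 t' <= t + K * L & data_bounded (K * L) (exec c x)].
Proof.
have one g g' : step g = [:: (1%R, g')] -> reach g g'.
  by move=> e; apply: reach_step e (reach_refl _).
elim: c => [a e|a|e|//|c1 IH1 c2 IH2|e c1 IH1 c2 IH2|//] /=.
- move=> _; have [Ka ha] := eval_bound a; have [Ke he] := eval_bound e.
  exists (Ka + Ke).+1 => L [[m i] o] t k L0 [/= bm bi].
  have [h1 h2] := ha L m L0 bm; have [h3 h4] := he L m L0 bm.
  eexists; split; [by apply: one| by rewrite /=; nia|].
  split=> [|v /bi]; last by move=> /= h; nia.
  by apply: bounded_upd => [b|]; [have := bm b; rewrite /=; nia | nia].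
- move=> _; have [Ka ha] := eval_bound a; exists Ka.+2 => L [[m i] o] t k L0 [/= bm bi].
  have [h1 h2] := ha L m L0 bm.
  have h : nbits (head 0 i) <= L.
    by case: (i) bi => //= v i' bi; apply: bi; rewrite inE eqxx.
  eexists; split; [by apply: one| by rewrite /=; nia|].
  split=> [|v vi]; last first.
    have /bi : v \in i by case: (i) vi => //= u i' vi; rewrite inE vi orbT.
    by move=> /= h'; nia.
  by apply: bounded_upd => [b|]; [have := bm b; rewrite /=; nia | nia].
- move=> _; have [Ke he] := eval_bound e; exists Ke.+1 => L [[m i] o] t k L0 [/= bm bi].
  have [h1 h2] := he L m L0 bm.
  eexists; split; [by apply: one| by rewrite /=; nia|].
  by split=> [b|v /bi /= h]; [have := bm b => /=; nia | nia].
- case/andP=> /IH1[K1 h1] /IH2[K2 h2]; exists (K1 + K2 * K1.+1 + 1) => L x t k L0 bx.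
  have [t1 [r1 le1 b1]] := h1 L x t.+1 (c2 :: k) L0 bx.
  have b1' : data_bounded (K1.+1 * L) (exec c1 x) by apply: data_bounded_le b1; nia.
  have [|t2 [r2 le2 b2]] := h2 (K1.+1 * L) (exec c1 x) t1 k _ b1'; first by nia.
  exists t2; case: x bx r1 b1 b1' r2 b2 => [[m i] o] bx r1 b1 b1' r2 b2; split.
  + by apply: reach_step (reach_trans r1 r2).
  + by nia.
  + by apply: data_bounded_le b2; nia.
- case/andP=> /IH1[K1 h1] /IH2[K2 h2]; have [Ke he] := eval_bound e.
  exists (K1 + K2 + Ke + 1) => L [[m i] o] t k L0 bx.
  have [e1 e2] := he L m L0 bx.1.
  have [t1 [r1 le1 b1]] := h1 L (m, i, o) (t + (cost m e).+1) k L0 bx.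
  have [t2 [r2 le2 b2]] := h2 L (m, i, o) (t + (cost m e).+1) k L0 bx.
  case ee: (eval m e != 0).
    exists t1; split; [|by nia|by apply: data_bounded_le b1; nia].
    by apply: reach_step r1; rewrite /= ee.
  exists t2; split; [|by nia|by apply: data_bounded_le b2; nia].
  by apply: reach_step r2; rewrite /= ee.
Qed.

Definition triple (P : data -> Prop) (c : cmd) (Q : data -> Prop) (T : nat) : Prop :=
  forall x t k, P x -> exists y t',
    [/\ reach (c :: k, at_time x t) (k, at_time y t'), Q y & t' <= t + T].

Lemma triple_weaken P P' c Q Q' T T' : (forall x, P' x -> P x) -> (forall x, Q x -> Q' x) ->
  T <= T' -> triple P c Q T -> triple P' c Q' T'.
Proof.
move=> PP QQ TT h x t k /PP /(h x t k)[y [t' [r q le]]]; exists y, t'; split=> //; first exact: QQ.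
by apply: leq_trans le _; rewrite leq_add2l.
Qed.

Lemma triple_seq P Q R c1 c2 T1 T2 :
  triple P c1 Q T1 -> triple Q c2 R T2 -> triple P (Seq c1 c2) R (T1 + T2).+1.
Proof.
move=> h1 h2 x t k /(h1 x t.+1 (c2 :: k))[y [t1 [r1 q le1]]].
have [z [t2 [r2 r le2]]] := h2 y t1 k q; exists z, t2; split=> //; last by lia.
by apply: reach_step (reach_trans r1 r2); case: (x) => [[m i] o].
Qed.

Lemma triple_straight c : straight c -> exists K, forall L (P Q : data -> Prop), 0 < L ->
  (forall x, P x -> data_bounded L x) -> (forall x, P x -> Q (exec c x)) ->
  triple P c Q (K * L).
Proof.
move=> /exec_bound[K h]; exists K => L P Q L0 Pb PQ x t k Px.
have [t' [r le _]] := h L x t k L0 (Pb x Px).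
by exists (exec c x), t'; split=> //; exact: PQ.
Qed.

(** The invariant is indexed by the number of completed iterations; the guard is evaluated once more
    than the body, whence [N.+1]. *)
Lemma triple_while e c : exists K, forall L N T (I : nat -> data -> Prop), 0 < L ->
  (forall j x, I j x -> data_bounded L x) ->
  (forall j x, j < N -> I j x -> eval x.1.1 e != 0) ->
  (forall x, I N x -> eval x.1.1 e = 0) ->
  (forall j, j < N -> triple (I j) c (I j.+1) T) ->
  triple (I 0) (While e c) (I N) (N.+1 * (K * L + T)).
Proof.
have [K he] := eval_bound e; exists K.+1 => L N T I L0 Ib nz z body.
suff gen d : d <= N -> triple (I (N - d)) (While e c) (I N) (d.+1 * (K.+1 * L + T)).
  by have := gen N (leqnn _); rewrite subnn.
elim: d => [_|d IH dN] x t k Ix.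
  rewrite subn0 in Ix; have [_ h2] := he L x.1.1 L0 (Ib _ _ Ix).1.
  exists x, (t + (cost x.1.1 e).+1); split=> //; last by nia.
  by apply: reach_step (reach_refl _); rewrite /= z.
have lt : N - d.+1 < N by lia.
have [_ h2] := he L x.1.1 L0 (Ib _ _ Ix).1.
have [y [t1 [r1 Iy le1]]] := body _ lt x (t + (cost x.1.1 e).+1) (While e c :: k) Ix.
have Nd : (N - d.+1).+1 = N - d by lia.
rewrite Nd in Iy; have [z' [t2 [r2 Iz le2]]] := IH (ltnW dN) y t1 k Iy.
exists z', t2; split=> //; last by nia.
by apply: reach_step (reach_trans r1 r2); rewrite /= (nz _ _ lt Ix).
Qed.

Lemma outcome_triple P c Q T k T' mu : triple P c Q T ->
  (forall y t, Q y -> outcome (k, at_time y t) (t + T') mu) ->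
  forall x t, P x -> outcome (c :: k, at_time x t) (t + (T + T')) mu.
Proof.
move=> h h' x t Px; have [y [t' [r Qy le]]] := h x t k Px.
apply: outcome_reach r _; apply: outcome_weaken (h' y t' Qy) => //.
by rewrite addnA leq_add2r.
Qed.

(** * The elimination phase *)

Arguments exec : simpl never.
Arguments upd : simpl never.

(* The cells below 16 are registers: 0 holds n, 1 holds n * n, 2 the main loop
   counter, 3 and 4 the counter and the degree of the row scan, 7, 5, 6 the
   vertices v, a, b, 8 / 9 the sum of the triangle weights, 10 the stamp, 11 and
   12 a coin and its bias, and 15 is a dummy.  Above them, cell ad f j is field f
   of entry j: fields 0 / 1 hold the weight of the pair (x, y) with
   j = x * n + y, field 2 its stamp (the pair is in the current cycle when this
   equals register 10), fields 3 to 9 the record of the j-th elimination. *)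
Definition ad (f j : nat) : nat := f + 16 * (1 + j).
Definition reg (r : nat) : expr := Get (Const r).
Definition slot (f : nat) (e : expr) : expr :=
  Op Add (Const f) (Op Mul (Const 16) (Op Add (Const 1) e)).
Definition cell (f : nat) (e : expr) : expr := Get (slot f e).
Definition flat (e1 e2 : expr) : expr := Op Add (Op Mul e1 (reg 0)) e2.
Definition put (r : nat) (e : expr) : cmd := Store (Const r) e.
Definition put2 (f : nat) (e1 e2 e : expr) : cmd :=
  Seq (Store (slot f (flat e1 e2)) e) (Store (slot f (flat e2 e1)) e).
Definition nop : cmd := put 15 (Const 0).
Definition block (l : seq cmd) : cmd := foldr Seq nop l.

Lemma eval_slot m f e : eval m (slot f e) = ad f (eval m e). Proof. by []. Qed.
Lemma eval_cell m f e : eval m (cell f e) = m (ad f (eval m e)). Proof. by []. Qed.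
Lemma eval_flat m e1 e2 : eval m (flat e1 e2) = eval m e1 * m 0 + eval m e2.
Proof. by []. Qed.
Lemma eval_reg m r : eval m (reg r) = m r. Proof. by []. Qed.
Lemma eval_const m k : eval m (Const k) = k. Proof. by []. Qed.
Lemma eval_Op m o e1 e2 : eval m (Op o e1 e2) = eval_op o (eval m e1) (eval m e2).
Proof. by []. Qed.
Definition evalE := (eval_slot, eval_cell, eval_flat, eval_reg, eval_const, eval_Op).

Lemma ad_eq f j f' j' : f < 16 -> f' < 16 -> (ad f j == ad f' j') = (f == f') && (j == j').
Proof.
move=> h h'; apply/eqP/andP => [|[/eqP -> /eqP ->] //]; rewrite /ad => e.
by split; apply/eqP; lia.
Qed.

Lemma upd_rr m r v r' : upd m r v r' = if r' == r then v else m r'.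
Proof. by []. Qed.

Definition upd_rrE m r v :=
  (upd_rr m r v 0, upd_rr m r v 1, upd_rr m r v 2, upd_rr m r v 3, upd_rr m r v 4, upd_rr m r v 5,
   upd_rr m r v 6, upd_rr m r v 7, upd_rr m r v 8, upd_rr m r v 9, upd_rr m r v 10,
   upd_rr m r v 11, upd_rr m r v 12).

Lemma upd_ar m f j v r : r < 16 -> upd m (ad f j) v r = m r.
Proof. by move=> r16; rewrite /upd; case: eqP => // e; rewrite /ad in e; lia. Qed.

Definition upd_arE m f j v :=
  (@upd_ar m f j v 0 isT, @upd_ar m f j v 1 isT, @upd_ar m f j v 2 isT, @upd_ar m f j v 5 isT,
   @upd_ar m f j v 6 isT, @upd_ar m f j v 7 isT).

Lemma upd_ra m r v f j : r < 16 -> upd m r v (ad f j) = m (ad f j).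
Proof. by move=> r16; rewrite /upd; case: eqP => // e; rewrite /ad in e; lia. Qed.

Definition upd_raE m v f j :=
  (@upd_ra m 15 v f j isT, @upd_ra m 2 v f j isT, @upd_ra m 5 v f j isT, @upd_ra m 6 v f j isT,
   @upd_ra m 7 v f j isT, @upd_ra m 8 v f j isT, @upd_ra m 9 v f j isT, @upd_ra m 10 v f j isT,
   @upd_ra m 11 v f j isT, @upd_ra m 12 v f j isT).

Lemma upd_aa m f j v f' j' : f < 16 -> f' < 16 ->
  upd m (ad f j) v (ad f' j') = if (f' == f) && (j' == j) then v else m (ad f' j').
Proof. by move=> h h'; rewrite /upd ad_eq. Qed.

Lemma exec_seq c1 c2 x : exec (Seq c1 c2) x = exec c2 (exec c1 x).
Proof. by case: x => [[m i] o]. Qed.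

Lemma exec_block c l x : exec (block (c :: l)) x = exec (block l) (exec c x).
Proof. exact: exec_seq. Qed.


Lemma exec_store a e m i o :
  exec (Store a e) (m, i, o) = (upd m (eval m a) (eval m e), i, o).
Proof. by []. Qed.

Lemma exec_put r e m i o : exec (put r e) (m, i, o) = (upd m r (eval m e), i, o).
Proof. by []. Qed.

Lemma exec_read a m i o :
  exec (Read a) (m, i, o) = (upd m (eval m a) (head 0 i), behead i, o).
Proof. by []. Qed.

Lemma exec_if e c1 c2 m i o :
  exec (If e c1 c2) (m, i, o) = if eval m e != 0 then exec c1 (m, i, o) else exec c2 (m, i, o).
Proof. by []. Qed.

Definition upd2 (n : nat) (m : nat -> nat) (f a b v : nat) : nat -> nat :=
  upd (upd m (ad f (a * n + b)) v) (ad f (b * n + a)) v.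

Lemma upd2_reg n m f a b v r : r < 16 -> upd2 n m f a b v r = m r.
Proof. by move=> r16; rewrite /upd2 !upd_ar. Qed.

Definition upd2_regE n m f a b v :=
  (@upd2_reg n m f a b v 0 isT, @upd2_reg n m f a b v 1 isT, @upd2_reg n m f a b v 2 isT,
   @upd2_reg n m f a b v 5 isT, @upd2_reg n m f a b v 6 isT, @upd2_reg n m f a b v 7 isT).

Lemma upd2_other n m f a b v f' j : f < 16 -> f' < 16 -> f' != f ->
  upd2 n m f a b v (ad f' j) = m (ad f' j).
Proof. by move=> h h' /negPf ff; rewrite /upd2 !upd_aa // ff. Qed.

Lemma flat_inj n (x y a b : 'I_n) : (x * n + y == a * n + b) = (x == a) && (y == b).
Proof.
apply/eqP/andP => [e|[/eqP -> /eqP ->] //].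
have n0 : 0 < n by apply: leq_ltn_trans (ltn_ord x).
have := congr1 (divn^~ n) e; rewrite !divnMDl // !divn_small // !addn0 => xa.
have := congr1 (modn^~ n) e; rewrite !modnMDl !modn_small // => yb.
by split; apply/eqP/val_inj.
Qed.

Lemma upd2_same n m f (a b x y : 'I_n) v : f < 16 ->
  upd2 n m f a b v (ad f (x * n + y)) =
  if [set x; y] == [set a; b] then v else m (ad f (x * n + y)).
Proof.
move=> h; rewrite /upd2 !upd_aa // eqxx /= !flat_inj set2_eq.
by rewrite orbC; case: ifP => //= ->.
Qed.

Lemma bounded_upd2 L n m f a b v : bounded L m -> nbits v <= L -> bounded L (upd2 n m f a b v).
Proof. by move=> bm bv; rewrite /upd2; do 2! apply: bounded_upd => //. Qed.

Lemma exec_put2 n f r1 r2 e m i o (a b v : nat) : f < 16 -> r1 < 16 -> r2 < 16 ->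
  m 0 = n -> m r1 = a -> m r2 = b -> eval m e = v ->
  eval (upd m (ad f (a * n + b)) v) e = v ->
  exec (put2 f (reg r1) (reg r2) e) (m, i, o) = (upd2 n m f a b v, i, o).
Proof.
move=> f16 r1_16 r2_16 m0 m1 m2 ev ev'; rewrite /put2 exec_seq !exec_store !evalE.
by rewrite !upd_ar // m0 m1 m2 ev ev'.
Qed.

(* Otherwise conversion compares addresses in unary. *)
Opaque upd upd2 ad.

(** A non-edge is read as 0, 0, 0. Adding 1 minus its flag to the denominator stores it as 0 / 1, as
    [wellformed] demands. *)
Definition read_body : cmd := block [::
  Read (Const 11); Read (slot 0 (reg 2)); Read (slot 1 (reg 2));
  Store (slot 1 (reg 2)) (Op Add (cell 1 (reg 2)) (Op Defs.Sub (Const 1) (reg 11)));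
  put 2 (Op Add (reg 2) (Const 1))].

Definition scan_body : cmd := block [::
  If (cell 0 (flat (reg 7) (reg 3)))
    (block [:: put 4 (Op Add (reg 4) (Const 1)); put 6 (reg 5); put 5 (reg 3)]) nop;
  put 3 (Op Add (reg 3) (Const 1))].

(** The vertex v is the main counter modulo n, so that a single loop up to n * n performs n rounds
    over all vertices. *)
Definition scan_init : cmd := block [::
  put 7 (Op Defs.Sub (reg 2) (Op Mul (Op Div (reg 2) (reg 0)) (reg 0)));
  put 4 (Const 0); put 5 (reg 7); put 6 (reg 7); put 3 (Const 0)].

Definition num (r1 r2 : nat) := cell 0 (flat (reg r1) (reg r2)).
Definition den (r1 r2 : nat) := cell 1 (flat (reg r1) (reg r2)).

Definition save_record : cmd :=
  let l := Op Mul (Op Mul (num 7 5) (num 7 6)) (den 5 6) in block [::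
  If (Op Defs.Sub (reg 4) (Const 2)) (block [:: put 5 (reg 7); put 6 (reg 7)]) nop;
  Store (slot 3 (reg 2)) (reg 7);
  Store (slot 4 (reg 2)) (reg 5);
  Store (slot 5 (reg 2)) (reg 6);
  Store (slot 6 (reg 2)) (Op Mul (Op Mul (num 7 5) (num 7 6)) (num 5 6));
  Store (slot 7 (reg 2)) (Op Mul (Op Mul (den 7 5) (den 7 6)) (den 5 6));
  Store (slot 8 (reg 2)) l;
  Store (slot 9 (reg 2)) (Op Add (Op Mul (Op Mul (num 5 6) (den 7 5)) (den 7 6)) l)].

(** The edges at v are written after ab, so that they prevail when padding makes the pairs coincide,
    as in [eliminate]. *)
Definition update_weights : cmd := block [::
  put2 0 (reg 5) (reg 6) (cell 9 (reg 2));
  put2 1 (reg 5) (reg 6) (cell 7 (reg 2));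
  put2 0 (reg 7) (reg 5) (Const 0); put2 1 (reg 7) (reg 5) (Const 1);
  put2 0 (reg 7) (reg 6) (Const 0); put2 1 (reg 7) (reg 6) (Const 1);
  put 2 (Op Add (reg 2) (Const 1))].

Definition eliminate_body : cmd :=
  Seq scan_init
    (Seq (While (Op Defs.Sub (reg 0) (reg 3)) scan_body) (Seq save_record update_weights)).

Section Forward.
Variables (n' L : nat).
Let n := n'.+1.
Hypothesis Lsmall : forall k, k <= (n * n).+1 -> nbits k <= L.

Definition record_at (m : nat -> nat) (j : nat) (r : record 'I_n) : Prop :=
  [/\ m (ad 3 j) = rv r, m (ad 4 j) = ra r & m (ad 5 j) = rb r] /\
  [/\ m (ad 6 j) = tnum r, m (ad 7 j) = tden r, m (ad 8 j) = lnum r & m (ad 9 j) = lden r].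

(** Here [rs] is the complete trace, of which the first i records are already stored. All stamps are
    0, below the stamp 1 with which sampling starts, so the initial cycle is empty. *)
Record forward_mem (w : weights 'I_n) (rs : seq (record 'I_n)) (i : nat) (m : nat -> nat) : Prop := {
  fwd_n : m 0 = n;
  fwd_nn : m 1 = n * n;
  fwd_i : m 2 = i;
  fwd_num : forall x y : 'I_n, m (ad 0 (x * n + y)) = (w [set x; y]).1;
  fwd_den : forall x y : 'I_n, m (ad 1 (x * n + y)) = (w [set x; y]).2;
  fwd_rec : forall j r0, j < i -> record_at m j (nth r0 rs j);
  fwd_stamp : forall j, m (ad 2 j) = 0;
  fwd_bounded : bounded L m }.

Lemma forward_upd_reg w rs i m r v : forward_mem w rs i m -> 2 < r -> r < 16 -> nbits v <= L ->
  forward_mem w rs i (upd m r v).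
Proof.
move=> [? ? ? ? ? re ? ?] r2 r16 vL.
have nr k : k <= 2 -> (k == r) = false by move=> k2; apply/eqP; lia.
split; rewrite ?upd_rr ?nr //; try (by move=> *; rewrite upd_ra).
  by move=> j r0 ji; have := re j r0 ji; rewrite /record_at !upd_ra.
exact: bounded_upd.
Qed.

Ltac upd_regs t := do ?(apply: forward_upd_reg; [| by [] | by [] | by t]).

Let ord_L (x : 'I_n) : nbits x <= L.
Proof. by apply: Lsmall; have := ltn_ord x; rewrite /n; nia. Qed.

Definition scan_mem w (v : 'I_n) (x : nat) (m : nat -> nat) : Prop :=
  let t := scan (adjacent w v) v (take x (enum 'I_n)) in
  [/\ m 7 = v, m 3 = x, m 4 = t.1.1, m 5 = t.1.2 & m 6 = t.2].

Lemma exec_scan_init w rs i m o ii (v : 'I_n) : forward_mem w rs i m -> i <= n * n -> i %% n = v ->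
  exists m', [/\ exec scan_init (m, ii, o) = (m', ii, o), forward_mem w rs i m' & scan_mem w v 0 m'].
Proof.
move=> fm ile iv; eexists; split.
- by rewrite /scan_init !exec_block !exec_put !evalE !upd_rr /=.
- have e : i - i %/ n * n = v by rewrite -iv {1}(divn_eq i n) addKn.
  by rewrite (fwd_n fm) (fwd_i fm) e; upd_regs ltac:(first [exact: ord_L | exact: Lsmall]).
- have e : i - i %/ n * n = v by rewrite -iv {1}(divn_eq i n) addKn.
  by rewrite /scan_mem take0 !upd_rr /= (fwd_n fm) (fwd_i fm) e.
Qed.

Lemma scan_rcons (V : finType) (f : pred V) v s x :
  scan f v (rcons s x) = scan_step f (scan f v s) x.
Proof. by rewrite /scan foldl_rcons. Qed.

Lemma scan_count_le (V : finType) (f : pred V) v s : (scan f v s).1.1 <= size s.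
Proof.
elim/last_ind: s => // s x IH; rewrite scan_rcons size_rcons /scan_step.
by case: ifP => _ //=; exact: leqW.
Qed.

Lemma exec_scan_body w rs i m o ii (v : 'I_n) x : forward_mem w rs i m -> scan_mem w v x m -> x < n ->
  exists m', [/\ exec scan_body (m, ii, o) = (m', ii, o), forward_mem w rs i m' & scan_mem w v x.+1 m'].
Proof.
move=> fm [m7 m3 m4 m5 m6] xn; rewrite /scan_body exec_block exec_if !evalE m7 m3 (fwd_n fm).
have -> : x = Ordinal xn by [].
rewrite (fwd_num fm) -/(adjacent w v (Ordinal xn)).
have scE : scan (adjacent w v) v (take x.+1 (enum 'I_n)) =
    scan_step (adjacent w v) (scan (adjacent w v) v (take x (enum 'I_n))) (Ordinal xn).
  rewrite (take_nth v) ?size_enum_ord // scan_rcons; congr scan_step.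
  by apply: val_inj; rewrite /= nth_enum_ord.
have xL : nbits x.+1 <= L by apply: Lsmall; have h := xn; rewrite /n in h *; nia.
case adj : (adjacent w v (Ordinal xn)); eexists; split.
- by rewrite !exec_block !exec_put !evalE !upd_rr /=.
- have cle := scan_count_le (adjacent w v) v (take x (enum 'I_n)).
  rewrite size_take size_enum_ord xn in cle.
  have cL : nbits ((scan (adjacent w v) v (take x (enum 'I_n))).1.1).+1 <= L.
    by apply: Lsmall; have h := xn; have h2 := cle; rewrite /n in h h2 *; nia.
  have x0L : nbits x <= L := ord_L (Ordinal xn).
  by rewrite ?m3 ?m5 ?m4 !addn1; upd_regs ltac:(first [exact: ord_L | exact: Lsmall | exact: xL | exact: cL | exact: x0L]).
- by rewrite /scan_mem !upd_rr /= scE /scan_step adj /= m3 m4 m5 !addn1.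
- by rewrite /nop !exec_block !exec_put !evalE !upd_rr /=.
- by rewrite m3 addn1; upd_regs ltac:(first [exact: xL | exact: Lsmall]).
- by rewrite /scan_mem !upd_rr /= scE /scan_step adj /= m3 m4 m5 !addn1.
Qed.

Definition select_mem w (v : 'I_n) (m : nat -> nat) : Prop :=
  [/\ m 7 = v, m 5 = (select w v).1 & m 6 = (select w v).2].

Lemma exec_save_record w rs i m o ii (v : 'I_n) M : wellformed w -> mass w <= M ->
  nbits (2 * M ^ 3) <= L ->
  forward_mem w rs i m -> scan_mem w v n m ->
  exists m', [/\ exec save_record (m, ii, o) = (m', ii, o), forward_mem w rs i m',
     select_mem w v m' & record_at m' i (record_of w v)].
Proof.
move=> ww wM ML fm [m7 _ m4 m5 m6].
have [b1 b2 b3] := record_bound v ww wM.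
have leL k : k <= 2 * M ^ 3 -> nbits k <= L by move=> h; apply: leq_trans ML; exact: leq_nbits.
rewrite /save_record exec_block exec_if !evalE.
have [m3 [-> fm3 [m37 m35 m36]]] : exists m3, [/\
    (if eval_op Defs.Sub (m 4) 2 != 0
     then exec (block [:: put 5 (reg 7); put 6 (reg 7)]) (m, ii, o)
     else exec nop (m, ii, o)) = (m3, ii, o),
    forward_mem w rs i m3 & select_mem w v m3].
  rewrite /nop !exec_block !exec_put !evalE !upd_rr /= m4 m7.
  rewrite /select_mem /select; rewrite take_oversize ?size_enum_ord // in m4 m5 m6 *.
  rewrite subn_eq0 -ltnNge; case: ifP => _; eexists; split=> //.
  - by upd_regs ltac:(first [exact: ord_L | exact: Lsmall]).
  - by upd_regs ltac:(exact: Lsmall).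
set a := (select w v).1 in m35 *; set b := (select w v).2 in m36 *.
have [e3 e4 e5 [e6 e7 e8 e9]] : [/\ (v : nat) = rv (record_of w v),
  (a : nat) = ra (record_of w v), (b : nat) = rb (record_of w v) &
  [/\ (w [set v; a]).1 * (w [set v; b]).1 * (w [set a; b]).1 = tnum (record_of w v),
  (w [set v; a]).2 * (w [set v; b]).2 * (w [set a; b]).2 = tden (record_of w v),
  (w [set v; a]).1 * (w [set v; b]).1 * (w [set a; b]).2 = lnum (record_of w v) &
  (w [set a; b]).1 * (w [set v; a]).2 * (w [set v; b]).2 + 
   (w [set v; a]).1 * (w [set v; b]).1 * (w [set a; b]).2 = lden (record_of w v)]].
  by rewrite /record_of -lock.
set r := record_of w v in e3 e4 e5 e6 e7 e8 e9 b1 b2 b3 *.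
exists (upd (upd (upd (upd (upd (upd (upd (upd m3 (ad 3 i) (rv r)) (ad 4 i) (ra r)) (ad 5 i) (rb r))
  (ad 6 i) (tnum r)) (ad 7 i) (tden r)) (ad 8 i) (lnum r)) (ad 9 i) (lden r)) 15 0); split.
- have F := (fwd_n fm3, fwd_i fm3, m37, m35, m36, fwd_num fm3, fwd_den fm3).
  rewrite !exec_block /num /den.
  do 7! rewrite exec_store !evalE ?upd_arE ?upd_aa //= ?F ?e6 ?e7 ?e8 ?e9 ?e3 ?e4 ?e5.
  by rewrite /nop exec_put evalE -e9 e8.
- have [? ? ? ? ? re ? ?] := fm3; split.
  + by rewrite upd_rr /= !upd_arE.
  + by rewrite upd_rr /= !upd_arE.
  + by rewrite upd_rr /= !upd_arE.
  + by move=> x y; rewrite upd_raE !upd_aa //=.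
  + by move=> x y; rewrite upd_raE !upd_aa //=.
  + move=> j r0 ji; have := re j r0 ji; rewrite /record_at !upd_raE !upd_aa //=.
    by have -> : (j == i) = false by apply/eqP; lia.
  + by move=> j; rewrite upd_raE !upd_aa //=.
  + have leM k : k <= M ^ 3 -> nbits k <= L.
      by move=> kM; apply: leL; apply: leq_trans kM _; exact: leq_pmull.
    have l6 := leM _ (leq_trans (leq_addr _ _) b1).
    have l7 := leM _ (leq_trans (leq_addl _ _) b1).
    have l8 := leM _ b2; have l9 := leL _ b3.
    by do ?(apply: bounded_upd; last by first [exact: ord_L | exact: Lsmall | assumption]).
- by split; rewrite upd_rr /= !upd_arE.
- by rewrite /record_at !upd_raE !upd_aa //= eqxx.
Qed.

Lemma exec_update_weights w rs i m o ii (v : 'I_n) : i < n * n ->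
  forward_mem w rs i m -> select_mem w v m -> record_at m i (record_of w v) ->
  (forall r0, nth r0 rs i = record_of w v) ->
  exists m', exec update_weights (m, ii, o) = (m', ii, o) /\
     forward_mem (eliminate w v) rs i.+1 m'.
Proof.
move=> inn [m0 m1 m2 fn fd fr fs fb] [m7 m5 m6] ri ir.
have [_ [_ d7 _ d9]] := ri; set a := (select w v).1 in m5; set b := (select w v).2 in m6.
set ld := lden (record_of w v) in d9 *; set td := tden (record_of w v) in d7 *.
exists (upd (upd (upd2 n (upd2 n (upd2 n (upd2 n (upd2 n (upd2 n m 0 a b ld) 1 a b td)
  0 v a 0) 1 v a 1) 0 v b 0) 1 v b 1) 2 i.+1) 15 0); split.
  rewrite /update_weights !exec_block.
  have put2E f r1 r2 e m3 (x y k : nat) : f < 16 -> r1 < 16 -> r2 < 16 -> m3 0 = n ->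
      m3 r1 = x -> m3 r2 = y -> eval m3 e = k -> eval (upd m3 (ad f (x * n + y)) k) e = k ->
      exec (put2 f (reg r1) (reg r2) e) (m3, ii, o) = (upd2 n m3 f x y k, ii, o).
    exact: exec_put2.
  rewrite (put2E 0 5 6 (cell 9 (reg 2)) m a b ld isT isT isT m0 m5 m6); first last.
  - by rewrite !evalE upd_arE upd_aa //= m2.
  - by rewrite !evalE m2.
  set m1' := upd2 n m 0 a b ld.
  have [p0 p5 p6 p7 p2] : [/\ m1' 0 = n, m1' 5 = a, m1' 6 = b, m1' 7 = v & m1' 2 = i].
    by rewrite /m1' !upd2_regE.
  rewrite (put2E 1 5 6 (cell 7 (reg 2)) m1' a b td isT isT isT p0 p5 p6); first last.
  - by rewrite !evalE upd_arE upd_aa //= p2 /m1' upd2_other.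
  - by rewrite !evalE p2 /m1' upd2_other.
  clearbody m1'; set m2' := upd2 n m1' 1 a b td.
  have {p0 p5 p6 p7 p2}[p0 p5 p6 p7 p2] :
      [/\ m2' 0 = n, m2' 5 = a, m2' 6 = b, m2' 7 = v & m2' 2 = i].
    by rewrite /m2' !upd2_regE.
  clearbody m2'.
  rewrite (put2E 0 7 5 (Const 0) m2' v a 0 isT isT isT p0 p7 p5 erefl erefl).
  rewrite (put2E 1 7 5 (Const 1) _ v a 1) ?upd2_regE // (put2E 0 7 6 (Const 0) _ v b 0) ?upd2_regE //.
  rewrite (put2E 1 7 6 (Const 1) _ v b 1) ?upd2_regE //.
  by rewrite !exec_put !evalE !upd2_regE p2 /= addn1.
have E (x y : 'I_n) : eliminate w v [set x; y] =
    if ([set x; y] == [set v; a]) || ([set x; y] == [set v; b]) then (0, 1)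
    else if [set x; y] == [set a; b] then (ld, td) else w [set x; y].
  by rewrite eliminateE /a /b; case: (select w v).
split.
- by rewrite !upd_rr /= !upd2_regE.
- by rewrite !upd_rr /= !upd2_regE.
- by rewrite !upd_rr.
- move=> x y; rewrite E !upd_raE.
  rewrite upd2_other // upd2_same // upd2_other // upd2_same // upd2_other // upd2_same // fn.
  by case: ifP => _; rewrite ?orbT //; case: ifP => _ //=; case: ifP.
- move=> x y; rewrite E !upd_raE.
  rewrite upd2_same // upd2_other // upd2_same // upd2_other // upd2_same // upd2_other // fd.
  by case: ifP => _; rewrite ?orbT //; case: ifP => _ //=; case: ifP.
- move=> j r0; rewrite ltnS leq_eqVlt => /predU1P[->|ji].
    by have := ri; rewrite ir /record_at !upd_raE; do 6! rewrite !upd2_other //.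
  by have := fr j r0 ji; rewrite /record_at !upd_raE; do 6! rewrite !upd2_other //.
- by move=> j; rewrite !upd_raE; do 6! rewrite upd2_other //.
- have lL : nbits ld <= L by rewrite -d9; exact: fb.
  have tL : nbits td <= L by rewrite -d7; exact: fb.
  have iL : nbits i.+1 <= L by apply: Lsmall; exact: leqW.
  do 2! (apply: bounded_upd; last by first [assumption | exact: Lsmall]).
  by do 6! (apply: bounded_upd2; last by first [assumption | exact: Lsmall]).
Qed.
End Forward.

Definition silent (P : (nat -> nat) -> Prop) (x : data) : Prop :=
  [/\ x.1.2 = [::], x.2 = [::] & P x.1.1].

Lemma silent_bounded L (P : (nat -> nat) -> Prop) x :
  (forall m, P m -> bounded L m) -> silent P x -> data_bounded L x.
Proof. by move=> Pb [e _ /Pb bm]; split=> //; rewrite e. Qed.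

(** Counters, vertices, degrees and stamps never exceed n * n + 1. *)
Definition small_bits (n L : nat) : Prop := forall k, k <= (n * n).+1 -> nbits k <= L.

Lemma small_bits_gt0 n L : small_bits n L -> 0 < L.
Proof. by move=> /(_ 0 isT). Qed.

Lemma eliminate_body_triple : exists K, forall n' L (w : weights 'I_n'.+1) rs i (v : 'I_n'.+1) M,
  small_bits n'.+1 L -> wellformed w -> mass w <= M -> nbits (2 * M ^ 3) <= L ->
  i < n'.+1 * n'.+1 -> i %% n'.+1 = v -> (forall r0, nth r0 rs i = record_of w v) ->
  triple (silent (forward_mem L w rs i)) eliminate_body
    (silent (forward_mem L (eliminate w v) rs i.+1)) (K * (n'.+3 * L)).
Proof.
have [K1 h1] := @triple_straight scan_init isT.
have [K2 h2] := @triple_straight scan_body isT.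
have [K3 h3] := @triple_straight save_record isT.
have [K4 h4] := @triple_straight update_weights isT.
have [K5 h5] := triple_while (Op Defs.Sub (reg 0) (reg 3)) scan_body.
exists (K1 + K2 + K3 + K4 + K5 + 3) => n' L w rs i v M sL ww wM ML inn iv ir.
have L0 := small_bits_gt0 sL.
pose I x := silent (fun m => forward_mem L w rs i m /\ scan_mem w v x m).
have Ib x y : I x y -> data_bounded L y by apply: silent_bounded => m [[]].
have t1 : triple (silent (forward_mem L w rs i)) scan_init (I 0) (K1 * L).
  apply: h1 => // [x|[[m ii] o] [/= -> -> fm]]; first by apply: silent_bounded => m [].
  by have [m' [-> f' s']] := exec_scan_init sL [::] [::] fm (ltnW inn) iv; split.
have t2 : triple (I 0) (While (Op Defs.Sub (reg 0) (reg 3)) scan_body) (I n'.+1)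
    (n'.+2 * (K5 * L + K2 * L)).
  apply: h5 => // [j x jn [_ _ [fm [_ m3 _ _ _]]]|x [_ _ [fm [_ m3 _ _ _]]]|j jn].
  - by rewrite !evalE (fwd_n fm) m3 /= subn_eq0 -ltnNge.
  - by rewrite !evalE (fwd_n fm) m3 /= subnn.
  - apply: h2 => // [x|[[m ii] o] [/= -> -> [fm sm]]]; first exact: Ib.
    by have [m' [-> f' s']] := exec_scan_body sL [::] [::] fm sm jn; split.
pose J := silent (fun m => [/\ forward_mem L w rs i m, select_mem w v m & record_at m i (record_of w v)]).
have t3 : triple (I n'.+1) save_record J (K3 * L).
  apply: h3 => // [x|[[m ii] o] [/= -> -> [fm sm]]]; first exact: Ib.
  by have [m' [-> f' s' r']] := exec_save_record sL [::] [::] ww wM ML fm sm; split.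
have t4 : triple J update_weights (silent (forward_mem L (eliminate w v) rs i.+1)) (K4 * L).
  apply: h4 => // [x|[[m ii] o] [/= -> -> [fm sm rm]]]; first by apply: silent_bounded => m [[]].
  by have [m' [-> f']] := exec_update_weights sL [::] [::] inn fm sm rm ir; split.
apply: triple_weaken (triple_seq t1 (triple_seq t2 (triple_seq t3 t4))) => //.
nia.
Qed.

Lemma size_trace (V : finType) (w : weights V) s : size (trace w s) = size s.
Proof. by elim: s w => //= v s IH w; rewrite IH. Qed.

Lemma nth_trace (V : finType) (w : weights V) s r0 v0 j : j < size s ->
  nth r0 (trace w s) j = record_of (foldl (@eliminate V) w (take j s)) (nth v0 s j).
Proof. by elim: s w j => //= v s IH w [|j] //=; rewrite ltnS => /IH ->. Qed.

Definition forward_loop : cmd := While (Op Defs.Sub (reg 1) (reg 2)) eliminate_body.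

Lemma forward_triple : exists K, forall n' L (w : weights 'I_n'.+1) (s : seq 'I_n'.+1) M,
  small_bits n'.+1 L -> wellformed w -> mass w <= M -> nbits (2 * M ^ 3) <= L ->
  size s = n'.+1 * n'.+1 ->
  (forall j v0, j < n'.+1 * n'.+1 -> nth v0 s j = j %% n'.+1 :> nat) ->
  triple (silent (forward_mem L w (trace w s) 0)) forward_loop
    (silent (forward_mem L (foldl (@eliminate _) w s) (trace w s) (n'.+1 * n'.+1)))
    (K * ((n'.+1 * n'.+1).+1 * (n'.+4 * L))).
Proof.
have [K1 h1] := eliminate_body_triple.
have [K2 h2] := triple_while (Op Defs.Sub (reg 1) (reg 2)) eliminate_body.
exists (K1 + K2) => n' L w s M sL ww wM ML ss sn.
have L0 := small_bits_gt0 sL.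
pose I j := silent (forward_mem L (foldl (@eliminate _) w (take j s)) (trace w s) j).
apply: (@triple_weaken (I 0) _ _ (I (n'.+1 * n'.+1)) _
    ((n'.+1 * n'.+1).+1 * (K2 * L + K1 * (n'.+3 * L)))).
- by move=> x; rewrite /I take0.
- by move=> x; rewrite /I take_oversize // ss.
- by nia.
apply: h2 => // [j x|j x jn [_ _ fm]|x [_ _ fm]|j jn].
- by apply: silent_bounded => m [].
- by rewrite !evalE (fwd_nn fm) (fwd_i fm) /= subn_eq0 -ltnNge.
- by rewrite !evalE (fwd_nn fm) (fwd_i fm) /= subnn.
have v0 : 'I_n'.+1 := ord0.
rewrite /I (take_nth v0) ?ss // foldl_rcons.
apply: (h1 _ _ _ _ _ _ M) => //; [exact: wellformed_foldl| | by rewrite sn|].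
  exact: leq_trans (mass_foldl _ ww) wM.
by move=> r0; rewrite (nth_trace _ _ v0) // ss.
Qed.

(** * Reading the input *)

Definition read_phase : cmd :=
  Seq (block [:: Read (Const 0); put 1 (Op Mul (reg 0) (reg 0))])
    (Seq (While (Op Defs.Sub (reg 1) (reg 2)) read_body) (put 2 (Const 0))).

Definition item (f : nat -> nat * nat * nat) (k : nat) : seq nat :=
  [:: (f k).1.1; (f k).1.2; (f k).2].

Lemma read_triple : exists K, forall n' L (w : weights 'I_n'.+1) (f : nat -> nat * nat * nat) rs,
  small_bits n'.+1 L ->
  (forall v, v \in flatten [seq item f k | k <- iota 0 (n'.+1 * n'.+1)] -> nbits v <= L) ->
  (forall k, k < n'.+1 * n'.+1 -> nbits ((f k).2 + (1 - (f k).1.1)) <= L) ->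
  (forall x y : 'I_n'.+1, ((f (x * n'.+1 + y)).1.2,
     (f (x * n'.+1 + y)).2 + (1 - (f (x * n'.+1 + y)).1.1)) = w [set x; y]) ->
  triple (fun x => x = (fun=> 0, n'.+1 :: flatten [seq item f k | k <- iota 0 (n'.+1 * n'.+1)], [::]))
    read_phase (silent (forward_mem L w rs 0)) (K * ((n'.+1 * n'.+1).+3 * L)).
Proof.
have [K1 h1] := @triple_straight (block [:: Read (Const 0); put 1 (Op Mul (reg 0) (reg 0))]) isT.
have [K2 h2] := @triple_straight read_body isT.
have [K3 h3] := triple_while (Op Defs.Sub (reg 1) (reg 2)) read_body.
have [K4 h4] := @triple_straight (put 2 (Const 0)) isT.
exists (K1 + K2 + K3 + K4 + 2) => n' L w f rs sL fL dL fw.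
have L0 := small_bits_gt0 sL; set n := n'.+1 in sL fL dL fw *.
have nL : nbits n <= L by apply: sL; rewrite /n; nia.
pose I j (x : data) := let: (m, ii, o) := x in
  [/\ j <= n * n, [/\ m 0 = n, m 1 = n * n & m 2 = j],
      ii = flatten [seq item f k | k <- iota j (n * n - j)] /\ o = [::],
      (forall k, k < j -> m (ad 0 k) = (f k).1.2 /\ m (ad 1 k) = (f k).2 + (1 - (f k).1.1)) /\
      (forall k, m (ad 2 k) = 0) & data_bounded L x].
have Ib j x : I j x -> data_bounded L x by case: x => [[m ii] o] [].
have t1 : triple (fun x => x = (fun=> 0, n :: flatten [seq item f k | k <- iota 0 (n * n)], [::]))
    (block [:: Read (Const 0); put 1 (Op Mul (reg 0) (reg 0))]) (I 0) (K1 * L).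
  apply: h1 => // x ->.
    by split=> [a|v] /=; [exact: sL|rewrite inE => /predU1P[->|/fL]].
  rewrite !exec_block exec_read !exec_put !evalE !upd_rr /=; split=> //.
  - by split=> // k; rewrite !upd_raE.
  - split=> [|v /fL //]; do 3! (apply: bounded_upd; last by first [exact: nL | apply: sL]).
    by move=> a; apply: sL.
have t2 : triple (I 0) (While (Op Defs.Sub (reg 1) (reg 2)) read_body) (I (n * n))
    ((n * n).+1 * (K3 * L + K2 * L)).
  apply: h3 => // [j [[m ii] o] jn [_ [_ m1 m2] _ _ _]|[[m ii] o] [_ [_ m1 m2] _ _ _]|j jn].
  - by rewrite [(m, ii, o).1.1]/= !evalE m1 m2 /= subn_eq0 -ltnNge.
  - by rewrite [(m, ii, o).1.1]/= !evalE m1 m2 /= subnn.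
  - apply: h2 => // [x|[[m ii] o] [_ [m0 m1 m2] [ei ->] [fm st] [bm bi]]]; first exact: Ib.
    have e : n * n - j = (n * n - j.+1).+1 by lia.
    rewrite e /= in ei.
    have ei' : ii = item f j ++ flatten [seq item f k | k <- iota j.+1 (n * n - j.+1)] := ei.
    pose m' := upd (upd (upd (upd (upd (upd m 11 (f j).1.1) (ad 0 j) (f j).1.2) (ad 1 j) (f j).2)
       (ad 1 j) ((f j).2 + (1 - (f j).1.1))) 2 j.+1) 15 0.
    have -> : exec read_body (m, ii, [::]) =
        (m', flatten [seq item f k | k <- iota j.+1 (n * n - j.+1)], [::]).
      rewrite /read_body !exec_block ei.
      rewrite exec_read !evalE /= exec_read !evalE upd_rr /= m2.
      rewrite exec_read !evalE upd_arE upd_rr /= m2 exec_store !evalE !upd_arE upd_rr /= m2.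
      rewrite upd_aa // !eqxx /= !(@upd_ar _ _ _ _ 11 isT) upd_rr eqxx.
      by rewrite !exec_put !evalE !upd_arE upd_rr /= m2 addn1.
    have jL : nbits j.+1 <= L by apply: sL; lia.
    have iL x : x \in item f j -> nbits x <= L.
      by move=> xi; apply: bi; rewrite /= ei' mem_cat xi.
    split=> //.
    + by split; rewrite /m' (upd_rr _ 15) (upd_rr _ 2) /= ?upd_arE ?(upd_rr _ 11).
    + split=> [k|k]; last by rewrite /m' !upd_raE !upd_aa //= upd_raE.
      rewrite ltnS leq_eqVlt => /predU1P[->|kj].
        by rewrite /m' !upd_raE !upd_aa //= !eqxx.
      have kj' : (k == j) = false by apply/eqP; lia.
      have [f1 f2] := fm k kj.
      by rewrite /m' !upd_raE !upd_aa //= kj' /= !upd_raE f1 f2.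
    + split=> [|v vi]; last by apply: bi; rewrite /= ei' mem_cat vi orbT.
      have z : nbits 0 <= L by apply: sL.
      have [l1 l2 l3] : [/\ nbits (f j).1.1 <= L, nbits (f j).1.2 <= L & nbits (f j).2 <= L].
        by split; apply: iL; rewrite !inE eqxx ?orbT.
      have l4 := dL j jn.
      by rewrite /= /m'; do ?(apply: bounded_upd; last assumption).
have t3 : triple (I (n * n)) (put 2 (Const 0)) (silent (forward_mem L w rs 0)) (K4 * L).
  apply: h4 => // [x|[[m ii] o] [_ [m0 m1 m2] [ei ->] [fm st] [bm bi]]]; first exact: Ib.
  rewrite exec_put evalE; split=> //; first by rewrite ei subnn.
  have jn (x y : 'I_n) : x * n + y < n * n by have := ltn_ord x; have := ltn_ord y; nia.
  split; rewrite /= ?upd_rr //.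
  - by move=> x y; rewrite upd_raE (fm _ (jn x y)).1 -fw.
  - by move=> x y; rewrite upd_raE (fm _ (jn x y)).2 -fw.
  - by apply: bounded_upd => //; exact: sL.
by apply: triple_weaken (triple_seq t1 (triple_seq t2 t3)) => //; nia.
Qed.

(** * The sampling phase *)

Lemma outcome_seq c1 c2 k x T mu :
  (forall t, outcome (c1 :: c2 :: k, at_time x t) (t + T) mu) ->
  forall t, outcome (Seq c1 c2 :: k, at_time x t) (t + T.+1) mu.
Proof.
move=> h t; apply: (@outcome_step _ (c1 :: c2 :: k, at_time x t.+1)) => //.
by rewrite addnS -addSn; exact: h.
Qed.

Lemma outcome_if e c1 c2 k x B T mu : cost x.1.1 e <= B ->
  (forall t, outcome ((if eval x.1.1 e != 0 then c1 else c2) :: k, at_time x t) (t + T) mu) ->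
  forall t, outcome (If e c1 c2 :: k, at_time x t) (t + (B.+1 + T)) mu.
Proof.
move=> cB h t.
apply: (@outcome_step _ ((if eval x.1.1 e != 0 then c1 else c2) :: k,
  at_time x (t + (cost x.1.1 e).+1))) => //.
by apply: outcome_weaken (h _) => //; rewrite addnA leq_add2r leq_add2l ltnS.
Qed.

Lemma outcome_toss_reg r p q k m B T mu1 mu0 :
  cost m (Const r) + cost m p + cost m q <= B ->
  (forall t, outcome (k, at_time (upd m r 1, [::], [::]) t) (t + T) mu1) ->
  (forall t, outcome (k, at_time (upd m r 0, [::], [::]) t) (t + T) mu0) ->
  forall t, outcome (Toss (Const r) p q :: k, at_time (m, [::], [::]) t) (t + (B.+1 + T))
    (fun y => bias (eval m p) (eval m q) * mu1 y + (1 - bias (eval m p) (eval m q)) * mu0 y)%R.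
Proof.
move=> cB h1 h0 t; have le : t + (cost m (Const r) + cost m p + cost m q).+1 + T <= t + (B.+1 + T).
  by rewrite addnA leq_add2r leq_add2l ltnS.
by apply: outcome_toss; [apply: outcome_weaken (h1 _) | apply: outcome_weaken (h0 _)].
Qed.

Definition sample_init : cmd := block [:: put 10 (Const 1); put 8 (Const 0); put 9 (Const 1)].

(** The partial sum is extended before the coin is tossed, so that register 12 over register 8 is
    the share of the triangle. Register 9 changes last because register 12 needs the old
    denominator. *)
Definition load_record : cmd := block [::
  put 2 (Op Defs.Sub (reg 2) (Const 1));
  put 7 (cell 3 (reg 2)); put 5 (cell 4 (reg 2)); put 6 (cell 5 (reg 2));
  put 12 (Op Mul (cell 6 (reg 2)) (reg 9));
  put 8 (Op Add (Op Mul (reg 8) (cell 7 (reg 2))) (reg 12));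
  put 9 (Op Mul (reg 9) (cell 7 (reg 2)))].

(* Incrementing the stamp in cell 10 discards the current cycle. *)
Definition take_triangle : cmd := block [::
  put 10 (Op Add (reg 10) (Const 1));
  put2 2 (reg 7) (reg 5) (reg 10); put2 2 (reg 7) (reg 6) (reg 10);
  put2 2 (reg 5) (reg 6) (reg 10)].

Definition take_detour : cmd := block [::
  put2 2 (reg 5) (reg 6) (Const 0);
  put2 2 (reg 7) (reg 5) (reg 10); put2 2 (reg 7) (reg 6) (reg 10)].

(** No stamp exceeds register 10, so with truncated subtraction the guard is non-zero exactly when
    the stamp of ab equals register 10, that is, when ab is in the current cycle. *)
Definition lift_cycle : cmd :=
  If (Op Defs.Sub (Op Add (cell 2 (flat (reg 5) (reg 6))) (Const 1)) (reg 10))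
    (Seq (Toss (Const 11) (cell 8 (reg 2)) (cell 9 (reg 2))) (If (reg 11) take_detour nop))
    nop.

Definition sample_body : cmd :=
  Seq load_record
    (Seq (Toss (Const 11) (reg 12) (reg 8)) (If (reg 11) take_triangle lift_cycle)).

Section Backward.
Variables (n' L : nat) (rs : seq (record 'I_n'.+1)).
Let n := n'.+1.
Hypothesis sL : small_bits n L.
Hypothesis zL : forall i, nbits (fraction_sum (drop i rs)).1 <= L /\
                          nbits (fraction_sum (drop i rs)).2 <= L.
Hypothesis rsn : size rs = n * n.

Definition stamped (m : nat -> nat) (C : {set {set 'I_n}}) : Prop :=
  forall x y : 'I_n, m (ad 2 (x * n + y)) <= m 10 /\
    (m (ad 2 (x * n + y)) == m 10) = ([set x; y] \in C).

(** In [smp_stamp], undoing a record lowers i by one and raises the stamp by at most one, so their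
    sum stays bounded and the stamp stays short. *)
Record sample_mem (i : nat) (C : {set {set 'I_n}}) (m : nat -> nat) : Prop := {
  smp_n : m 0 = n;
  smp_nn : m 1 = n * n;
  smp_i : m 2 = i;
  smp_num : m 8 = (fraction_sum (drop i rs)).1;
  smp_den : m 9 = (fraction_sum (drop i rs)).2;
  smp_stamp : 0 < m 10 /\ m 10 + i <= (n * n).+1;
  smp_rec : forall j r0, j < n * n -> record_at m j (nth r0 rs j);
  smp_cycle : stamped m C;
  smp_bounded : bounded L m }.

Definition loaded (i : nat) (C : {set {set 'I_n}}) (r : record 'I_n) (m : nat -> nat) : Prop :=
  [/\ sample_mem i C m, m 10 + i <= n * n,
      m 12 = tnum r * (fraction_sum (drop i.+1 rs)).2,
      [/\ m 7 = rv r, m 5 = ra r & m 6 = rb r] & record_at m i r].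

Let ord_L (x : 'I_n) : nbits x <= L.
Proof. by apply: sL; have := ltn_ord x; rewrite /n; nia. Qed.

Lemma stamped_upd_reg m C r v : r < 16 -> r != 10 -> stamped m C -> stamped (upd m r v) C.
Proof.
by move=> r16 r10 st x y; rewrite upd_ra // (upd_rr m r v 10) eq_sym (negPf r10); exact: st.
Qed.

Lemma exec_load_record i C r m : i < n * n -> (forall r0, nth r0 rs i = r) ->
  sample_mem i.+1 C m ->
  exists m', exec load_record (m, [::], [::]) = (m', [::], [::]) /\ loaded i C r m'.
Proof.
move=> inn ir sm; have [m0 m1 m2 m8 m9 [m10 m10'] re st bm] := sm.
have ri := re i r inn; rewrite ir in ri; have [[r3 r4 r5] [r6 r7 r8 r9]] := ri.
set z := fraction_sum (drop i.+1 rs) in m8 m9.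
have dE : fraction_sum (drop i rs) = total_step r z.
  by rewrite (drop_nth r) ?rsn // ir.
exists (upd (upd (upd (upd (upd (upd (upd (upd m 2 i) 7 (rv r)) 5 (ra r)) 6 (rb r))
   12 (tnum r * z.2)) 8 (z.1 * tden r + tnum r * z.2)) 9 (z.2 * tden r)) 15 0); split.
  rewrite /load_record !exec_block.
  rewrite exec_put !evalE m2 /= subn1 /=.
  rewrite exec_put !evalE !upd_rrE /= !upd_raE r3.
  rewrite exec_put !evalE !upd_rrE /= !upd_raE r4.
  rewrite exec_put !evalE !upd_rrE /= !upd_raE r5.
  rewrite exec_put !evalE !upd_rrE /= !upd_raE r6 m9.
  rewrite exec_put !evalE !upd_rrE /= !upd_raE r7 m8.
  by rewrite exec_put !evalE !upd_rrE /= !upd_raE r7 m9.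
have [z1L z2L] := zL i; rewrite dE /total_step /= in z1L z2L.
have pL : nbits (tnum r * z.2) <= L by apply: leq_trans z1L; apply: leq_nbits; exact: leq_addl.
split.
- split; rewrite ?upd_rr //=.
  + by rewrite dE.
  + by rewrite dE.
  + by split=> //; lia.
  + by move=> j r0 jn; have := re j r0 jn; rewrite /record_at !upd_raE.
  + by do 8! (apply: stamped_upd_reg => //).
  + have iL : nbits i <= L by apply: sL; lia.
    by do ?(apply: bounded_upd; last by first [assumption | exact: ord_L | exact: sL]).
- by rewrite !upd_rr /=; lia.
- by rewrite !upd_rr.
- by split; rewrite !upd_rr.
- by rewrite /record_at !upd_raE.
Qed.

Lemma loaded_upd i C r m b : b <= 1 -> loaded i C r m -> loaded i C r (upd m 11 b).
Proof.
move=> b1 [[m0 m1 m2 m8 m9 m10 re st bm] l2 l3 [l4 l5 l6] l7].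
have nr k : k != 11 -> upd m 11 b k = m k by move=> /negPf h; rewrite upd_rr h.
split; rewrite ?nr //; last by rewrite /record_at !upd_raE.
split; rewrite ?nr //.
- by move=> j r0 jn; have := re j r0 jn; rewrite /record_at !upd_raE.
- exact: stamped_upd_reg.
- apply: bounded_upd => //; apply: sL; exact: leq_trans b1 _.
Qed.

Lemma exec_nop_loaded i C r m : loaded i C r m ->
  exists m', exec nop (m, [::], [::]) = (m', [::], [::]) /\ sample_mem i C m'.
Proof.
move=> [[m0 m1 m2 m8 m9 m10 re st bm] _ _ _ _].
exists (upd m 15 0); split; first by rewrite /nop exec_put evalE.
have nr k : k != 15 -> upd m 15 0 k = m k by move=> /negPf h; rewrite upd_rr h.
split; rewrite ?nr //.
- by move=> j r0 jn; have := re j r0 jn; rewrite /record_at !upd_raE.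
- exact: stamped_upd_reg.
- by apply: bounded_upd => //; exact: sL.
Qed.

Lemma exec_take_triangle i C r m : loaded i C r m ->
  exists m', exec take_triangle (m, [::], [::]) = (m', [::], [::]) /\
    sample_mem i (triangle (rv r) (ra r) (rb r)) m'.
Proof.
move=> [[m0 m1 m2 m8 m9 [m10 _] re st bm] l2 l3 [l4 l5 l6] l7].
set v := rv r in l4 *; set a := ra r in l5 *; set b := rb r in l6 *.
set g := (m 10).+1; set m' := upd m 10 g.
have nr k : k != 10 -> m' k = m k by move=> /negPf h; rewrite /m' upd_rr h.
have m'10 : m' 10 = g by rewrite /m' upd_rr.
exists (upd (upd2 n (upd2 n (upd2 n m' 2 v a g) 2 v b g) 2 a b g) 15 0); split.
  rewrite /take_triangle !exec_block exec_put !evalE /= addn1 -/g -/m'.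
  rewrite (@exec_put2 n 2 7 5 (reg 10) _ _ _ v a g) ?evalE ?upd_ar ?m'10 ?nr //.
  rewrite (@exec_put2 n 2 7 6 (reg 10) _ _ _ v b g) ?evalE ?upd_ar ?upd2_reg ?m'10 ?nr //.
  by rewrite (@exec_put2 n 2 5 6 (reg 10) _ _ _ a b g) ?evalE ?upd_ar ?upd2_reg ?m'10 ?nr.
have gL : nbits g <= L by apply: sL; rewrite /g; lia.
have rg k : k < 16 -> k != 15 -> k != 10 ->
   upd (upd2 n (upd2 n (upd2 n m' 2 v a g) 2 v b g) 2 a b g) 15 0 k = m k.
  by move=> k16 /negPf k15 k10; rewrite upd_rr k15 !upd2_reg // nr.
have r10 : upd (upd2 n (upd2 n (upd2 n m' 2 v a g) 2 v b g) 2 a b g) 15 0 10 = g.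
  by rewrite upd_rr /= !upd2_reg.
split; rewrite ?r10 ?rg //.
- move=> j r0 jn; have := re j r0 jn; rewrite /record_at !upd_raE.
  by do 3! rewrite ?upd2_other //; rewrite /m' !upd_raE.
- move=> x y; rewrite r10 upd_raE !upd2_same //.
  have [st1 _] := st x y; rewrite /m' upd_raE /triangle !inE.
  case: ifP => _; first by rewrite leqnn eqxx orbT.
  case: ifP => _; first by rewrite leqnn eqxx orbT.
  case: ifP => _; first by rewrite leqnn eqxx.
  by split; [exact: leqW | apply/eqP => e; rewrite e /g ltnn in st1].
- apply: bounded_upd; last exact: sL.
  do 3! (apply: bounded_upd2; last assumption).
  exact: bounded_upd.
Qed.

Lemma exec_take_detour i C r m : loaded i C r m -> 
  exists m', exec take_detour (m, [::], [::]) = (m', [::], [::]) /\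
    sample_mem i (detour (rv r) (ra r) (rb r) C) m'.
Proof.
move=> [[m0 m1 m2 m8 m9 [m10 m10'] re st bm] l2 l3 [l4 l5 l6] l7].
set v := rv r in l4 *; set a := ra r in l5 *; set b := rb r in l6 *.
set g := m 10.
exists (upd (upd2 n (upd2 n (upd2 n m 2 a b 0) 2 v a g) 2 v b g) 15 0); split.
  rewrite /take_detour !exec_block.
  rewrite (@exec_put2 n 2 5 6 (Const 0) _ _ _ a b 0) //.
  rewrite (@exec_put2 n 2 7 5 (reg 10) _ _ _ v a g) ?evalE ?upd_ar ?upd2_reg //.
  by rewrite (@exec_put2 n 2 7 6 (reg 10) _ _ _ v b g) ?evalE ?upd_ar ?upd2_reg.
have gL : nbits g <= L by exact: bm.
have rg k : k < 16 -> k != 15 ->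
   upd (upd2 n (upd2 n (upd2 n m 2 a b 0) 2 v a g) 2 v b g) 15 0 k = m k.
  by move=> k16 /negPf k15; rewrite upd_rr k15 !upd2_reg.
split; rewrite ?rg //.
- move=> j r0 jn; have := re j r0 jn; rewrite /record_at !upd_raE.
  by do 3! rewrite ?upd2_other //.
- move=> x y; rewrite (rg 10) // upd_raE !upd2_same // -/g /detour !inE.
  case: ifP => _; first by rewrite leqnn eqxx orbT.
  case: ifP => _; first by rewrite leqnn eqxx.
  case: ifP => _ /=; last exact: st.
  (* The stamp 0 removes ab from the cycle because register 10 is positive. *)
  by rewrite eq_sym -[_ == 0]negbK -lt0n m10.
- apply: bounded_upd; last exact: sL.
  by do 3! (apply: bounded_upd2; last by first [assumption | exact: sL]).
Qed.
End Backward.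

Lemma outcome_ext g T mu mu' : mu =1 mu' -> outcome g T mu -> outcome g T mu'.
Proof. by move=> e; apply: outcome_weaken. Qed.

(* The law of the final output when the i first records remain to be undone. *)
Fixpoint back (V : finType) (rs : seq (record V)) (i : nat) (f : {set {set V}} -> rat) :
    {set {set V}} -> rat :=
  if i is i'.+1 then
    if drop i' rs is r :: rs' then record_kernel r (fraction_sum rs') (back rs i' f) else f
  else f.

(** [law] recurses on the list, [back] on the number of records still to undo, as the loop does.
    After k steps [law] has absorbed exactly the kernels of the first k records into its
    function. *)
Lemma back_law (V : finType) (rs : seq (record V)) f : law rs f = back rs (size rs) f set0.
Proof.
suff gen k : k <= size rs -> law rs f = law (drop k rs) (back rs k f).
  by rewrite (gen _ (leqnn _)) drop_size.
elim: k => [|k IH] kn; first by rewrite drop0.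
rewrite IH 1?ltnW //=; case e: (drop k rs) => [|r rs'].
  by have := congr1 size e; rewrite size_drop /=; lia.
by rewrite /= -[k.+1]add1n -drop_drop e /= drop0.
Qed.

Definition sample_loop : cmd := While (reg 2) sample_body.

Lemma triple_loaded (P Q : (nat -> nat) -> Prop) K c L :
  (forall L (P Q : data -> Prop), 0 < L ->
  (forall x, P x -> data_bounded L x) -> (forall x, P x -> Q (exec c x)) ->
  triple P c Q (K * L)) -> 0 < L ->
  (forall m, P m -> bounded L m) ->
  (forall m, P m -> exists m', exec c (m, [::], [::]) = (m', [::], [::]) /\ Q m') ->
  triple (silent P) c (silent Q) (K * L).
Proof.
move=> h L0 Pb PQ; apply: h => // [x|[[m ii] o] [/= -> -> Pm]]; first exact: silent_bounded.
by have [m' [-> Qm]] := PQ m Pm; split.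
Qed.

(** A [triple] describes only deterministic runs, so the loop is treated by induction on the number
    of records left, with the law of the continuation k as data: each iteration pulls the function f
    y back through one kernel. *)
Lemma sample_loop_outcome : exists K, forall n' L (rs : seq (record 'I_n'.+1)) k T'
    (f : seq nat -> {set {set 'I_n'.+1}} -> rat),
  small_bits n'.+1 L ->
  (forall i, nbits (fraction_sum (drop i rs)).1 <= L /\ nbits (fraction_sum (drop i rs)).2 <= L) ->
  size rs = n'.+1 * n'.+1 ->
  (forall C m t, sample_mem L rs 0 C m ->
     outcome (k, at_time (m, [::], [::]) t) (t + T') (fun y => f y C)) ->
  forall i C m t, i <= n'.+1 * n'.+1 -> sample_mem L rs i C m ->
    outcome (sample_loop :: k, at_time (m, [::], [::]) t) (t + (i.+1 * (K * L) + T'))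
      (fun y => back rs i (f y) C).
Proof.
have [K1 h1] := @triple_straight load_record isT.
have [K2 h2] := @triple_straight take_triangle isT.
have [K3 h3] := @triple_straight take_detour isT.
have [K4 h4] := @triple_straight nop isT.
have [B1 b1] := eval_bound (reg 2).
have [B2 b2] := eval_bound (reg 11).
(* The machine never evaluates this sum nor the one for [B5]; their costs dominate those of the
   three arguments of a [Toss]. *)
have [B3 b3] := eval_bound (Op Add (Op Add (Const 11) (reg 12)) (reg 8)).
have [B4 b4] := eval_bound (Op Defs.Sub (Op Add (cell 2 (flat (reg 5) (reg 6))) (Const 1)) (reg 10)).
have [B5 b5] := eval_bound (Op Add (Op Add (Const 11) (cell 8 (reg 2))) (cell 9 (reg 2))).
exists (K1 + K2 + K3 + K4 + B1 + B2 + B2 + B3 + B4 + B5 + 10) => n' L rs k T' f sL zL rsn fin.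
set K := (_ + 10); set n := n'.+1 in sL rsn fin *.
have L0 := small_bits_gt0 sL.
elim=> [|i IH] C m t ile sm.
  have [m0 m1 m2 m8 m9 [m10 _] re st bm] := sm.
  apply: (@outcome_step _ (k, at_time (m, [::], [::]) (t + (cost m (reg 2)).+1))).
    by rewrite /= m2.
  apply: outcome_weaken (fin C m _ sm) => //.
  have [_] := b1 L m L0 bm; rewrite /K; nia.
have [r0 _] : exists r0 : record 'I_n, True by exists (Record ord0 ord0 ord0 0 0 0 0).
set r := nth r0 rs i.
have ir r1 : nth r1 rs i = r by apply: set_nth_default; rewrite rsn.
have dr : drop i rs = r :: drop i.+1 rs by rewrite (drop_nth r0) ?rsn.
set T := i.+1 * (K * L) + T'.
have IH' C' m' t' : sample_mem L rs i C' m' ->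
    outcome (sample_loop :: k, at_time (m', [::], [::]) t') (t' + T)
      (fun y => back rs i (f y) C').
  by move=> sm'; apply: IH => //; exact: ltnW.
have sb C' m' : sample_mem L rs i C' m' -> bounded L m' by case.
have lb C' m' : loaded L rs i C' r m' -> bounded L m' by case=> [[]].
have tri C' m' t' : loaded L rs i C' r m' ->
    outcome (take_triangle :: sample_loop :: k, at_time (m', [::], [::]) t') (t' + (K2 * L + T))
      (fun y => back rs i (f y) (triangle (rv r) (ra r) (rb r))).
  move=> lm; apply: (@outcome_triple (silent (loaded L rs i C' r)) _
     (silent (sample_mem L rs i (triangle (rv r) (ra r) (rb r))))) => //.
    apply: triple_loaded h2 _ _ _ => // [m''|m'']; first exact: lb.
    by apply: exec_take_triangle.
  by move=> [[m'' ii] o] t'' [/= -> -> sm'']; exact: IH'.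
have det C' m' t' : loaded L rs i C' r m' ->
    outcome (take_detour :: sample_loop :: k, at_time (m', [::], [::]) t') (t' + (K3 * L + T))
      (fun y => back rs i (f y) (detour (rv r) (ra r) (rb r) C')).
  move=> lm; apply: (@outcome_triple (silent (loaded L rs i C' r)) _
     (silent (sample_mem L rs i (detour (rv r) (ra r) (rb r) C')))) => //.
    apply: triple_loaded h3 _ _ _ => // [m''|m'']; first exact: lb.
    by apply: exec_take_detour.
  by move=> [[m'' ii] o] t'' [/= -> -> sm'']; exact: IH'.
have nopo C' m' t' : loaded L rs i C' r m' ->
    outcome (nop :: sample_loop :: k, at_time (m', [::], [::]) t') (t' + (K4 * L + T))
      (fun y => back rs i (f y) C').
  move=> lm; apply: (@outcome_triple (silent (loaded L rs i C' r)) _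
     (silent (sample_mem L rs i C'))) => //.
    apply: triple_loaded h4 _ _ _ => // [m''|m'']; first exact: lb.
    by apply: exec_nop_loaded.
  by move=> [[m'' ii] o] t'' [/= -> -> sm'']; exact: IH'.
have lift C' m' t' : loaded L rs i C' r m' ->
    outcome (lift_cycle :: sample_loop :: k, at_time (m', [::], [::]) t')
      (t' + ((B4 * L).+1 + ((B5 * L).+1 + ((B2 * L).+1 + ((K3 + K4) * L + T))).+1))
      (fun y => mix_record r (back rs i (f y)) C').
  move=> lm; have bm' := lb _ _ lm.
  have [[m0 m1 m2 m8 m9 [m10 m10'] re st bm] l2 l3 [l4 l5 l6] l7] := lm.
  rewrite /lift_cycle; apply: outcome_if => [|t1]; first by have [] := b4 L m' L0 bm'.
  have -> : (eval (m', [::] : seq nat, [::] : seq nat).1.1 (Op Defs.Sub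
      (Op Add (cell 2 (flat (reg 5) (reg 6))) (Const 1)) (reg 10)) != 0) = ([set ra r; rb r] \in C').
    have [le <-] := st (ra r) (rb r).
    rewrite [(m', _, _).1.1]/= !evalE m0 l5 l6 /= subn_eq0 addn1 -ltnNge ltnS eqn_leq le.
    by [].
  rewrite /mix_record /mix; case: ifP => abC; last first.
    by apply: outcome_weaken (nopo _ _ _ lm) => //; nia.
  apply: outcome_seq => t2.
  have [_ [_ _ l78 l79]] := l7.
  have e8 : eval m' (cell 8 (reg 2)) = lnum r by rewrite !evalE m2.
  have e9 : eval m' (cell 9 (reg 2)) = lden r by rewrite !evalE m2.
  rewrite -e8 -e9; apply: outcome_toss_reg => [|t3|t3].
  - have [_] := b5 L m' L0 bm'; rewrite [cost _ (Op _ (Op _ _ _) _)]/=.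
    rewrite -[_ + (_ + _)]/(cost m' (Op Add (Op Add (Const 11) (cell 8 (reg 2))) (cell 9 (reg 2)))).
    by move=> h; apply: leq_trans h; rewrite /=; lia.
  - have lm1 := loaded_upd sL (leqnn 1) lm.
    apply: outcome_if => [|t4]; first by have [] := b2 L _ L0 (lb _ _ lm1).
    rewrite [(_, _, _).1.1]/= evalE upd_rr /=.
    by apply: outcome_weaken (det _ _ _ lm1) => //; nia.
  - have lm1 := loaded_upd sL (leq0n 1) lm.
    apply: outcome_if => [|t4]; first by have [] := b2 L _ L0 (lb _ _ lm1).
    rewrite [(_, _, _).1.1]/= evalE upd_rr /=.
    by apply: outcome_weaken (nopo _ _ _ lm1) => //; nia.
have [m0 m1 m2 m8 m9 [m10 _] re st bm] := sm.
pose T3 := (B4 * L).+1 + ((B5 * L).+1 + ((B2 * L).+1 + ((K3 + K4) * L + T))).+1.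
pose T2 := (B3 * L).+1 + ((B2 * L).+1 + (K2 * L + T3)).
pose T1 := (K1 * L + T2.+1).+1.
have bodyo t' : outcome (sample_body :: sample_loop :: k, at_time (m, [::], [::]) t') (t' + T1)
    (fun y => back rs i.+1 (f y) C).
  apply: outcome_seq => t1.
  apply: (@outcome_triple (silent (sample_mem L rs i.+1 C)) _ (silent (loaded L rs i C r))) => //.
    apply: triple_loaded h1 _ _ _ => // [m''|m'']; first by case.
    exact: exec_load_record.
  move=> [[m' ii] o] t2 [/= -> -> lm]; apply: outcome_seq => t3.
  have bm' := lb _ _ lm.
  have [[m'0 _ m'2 m'8 m'9 _ _ _ _] l2 l3 _ _] := lm.
  apply: (@outcome_ext _ _ (fun y =>
     bias (eval m' (reg 12)) (eval m' (reg 8)) * back rs i (f y) (triangle (rv r) (ra r) (rb r)) +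
     (1 - bias (eval m' (reg 12)) (eval m' (reg 8))) * mix_record r (back rs i (f y)) C)%R).
    by move=> y; rewrite /= dr l3 m'8 dr.
  apply: outcome_toss_reg => [|t4|t4].
  - have [_] := b3 L m' L0 bm' => h; apply: leq_trans h; rewrite /=; lia.
  - have lm1 := loaded_upd sL (leqnn 1) lm.
    apply: outcome_if => [|t5]; first by have [] := b2 L _ L0 (lb _ _ lm1).
    rewrite [(_, _, _).1.1]/= evalE upd_rr /=.
    by apply: outcome_weaken (tri _ _ _ lm1) => //; rewrite /T3; nia.
  - have lm1 := loaded_upd sL (leq0n 1) lm.
    apply: outcome_if => [|t5]; first by have [] := b2 L _ L0 (lb _ _ lm1).
    rewrite [(_, _, _).1.1]/= evalE upd_rr /=.
    by apply: outcome_weaken (lift _ _ _ lm1) => //; rewrite -/T3; nia.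
apply: (@outcome_step _ (sample_body :: sample_loop :: k,
  at_time (m, [::], [::]) (t + (cost m (reg 2)).+1))).
  by rewrite /= m2.
apply: outcome_weaken (bodyo _) => //.
have [_] := b1 L m L0 bm; rewrite /T1 /T2 /T3 /T /K; nia.
Qed.

Lemma exec_sample_init n' L (w : weights 'I_n'.+1) rs m : small_bits n'.+1 L ->
  size rs = n'.+1 * n'.+1 -> forward_mem L w rs (n'.+1 * n'.+1) m ->
  exists m', exec sample_init (m, [::], [::]) = (m', [::], [::]) /\
    sample_mem L rs (n'.+1 * n'.+1) set0 m'.
Proof.
move=> sL rsn [m0 m1 m2 _ _ re st bm].
exists (upd (upd (upd (upd m 10 1) 8 0) 9 1) 15 0); split.
  by rewrite /sample_init !exec_block !exec_put !evalE.
have dn : drop (n'.+1 * n'.+1) rs = [::] by rewrite -rsn drop_size.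
split; rewrite ?dn.
- by rewrite !upd_rrE.
- by rewrite !upd_rrE.
- by rewrite !upd_rrE.
- by rewrite !upd_rrE.
- by rewrite !upd_rrE.
- by rewrite !upd_rrE /=; lia.
- by move=> j r0 jn; have := re j r0 jn; rewrite /record_at !upd_raE.
- by move=> x y; rewrite !upd_rrE !upd_raE st inE.
- by do 4! (apply: bounded_upd; last exact: sL).
Qed.

Lemma allpairs_iota (T : Type) (F : nat -> nat -> T) a b :
  [seq F x y | x <- iota 0 a, y <- iota 0 b] = [seq F (j %/ b) (j %% b) | j <- iota 0 (a * b)].
Proof.
elim: a => [|a IH] //.
rewrite -addn1 mulnDl mul1n !iotaD allpairs_cat map_cat IH !add0n /= cats0; congr (_ ++ _).
rewrite -[in RHS](addn0 (a * b)) iotaDl -map_comp; apply/eq_in_map => y /=.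
rewrite mem_iota add0n => /andP[_ yb].
by rewrite divnMDl ?modnMDl ?divn_small ?modn_small ?addn0 //; lia.
Qed.

Lemma enum_ord_inord n' : enum 'I_n'.+1 = [seq inord i | i <- iota 0 n'.+1].
Proof.
apply: (inj_map val_inj); rewrite val_enum_ord -map_comp -[LHS]map_id.
by apply/eq_in_map => i; rewrite mem_iota /= => ?; rewrite inordK.
Qed.

Lemma allpairs_ord (T : Type) n' (F : 'I_n'.+1 -> 'I_n'.+1 -> T) :
  [seq F x y | x <- enum 'I_n'.+1, y <- enum 'I_n'.+1] =
  [seq F (inord (j %/ n'.+1)) (inord (j %% n'.+1)) | j <- iota 0 (n'.+1 * n'.+1)].
Proof. by rewrite enum_ord_inord allpairs_mapl allpairs_mapr allpairs_iota. Qed.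

(** * Writing the output *)

Definition write_body : cmd := block [::
  Write (Op Defs.Sub (Op Add (cell 2 (reg 2)) (Const 1)) (reg 10));
  put 2 (Op Add (reg 2) (Const 1))].

Definition write_phase : cmd := While (Op Defs.Sub (reg 1) (reg 2)) write_body.

Lemma write_triple : exists K, forall n' L (rs : seq (record 'I_n'.+1)) C,
  small_bits n'.+1 L ->
  triple (silent (sample_mem L rs 0 C)) write_phase
    (fun x => x.2 = encode_cycle C) (K * ((n'.+1 * n'.+1).+1 * L)).
Proof.
have [K1 h1] := @triple_straight write_body isT.
have [K2 h2] := triple_while (Op Defs.Sub (reg 1) (reg 2)) write_body.
exists (K1 + K2) => n' L rs C sL; have L0 := small_bits_gt0 sL.
set n := n'.+1 in sL *.
pose g j : nat := [set (inord (j %/ n) : 'I_n); inord (j %% n)] \in C.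
pose I j (x : data) := let: (m, ii, o) := x in
  [/\ ii = [::], o = [seq g k | k <- iota 0 j], m 1 = n * n /\ m 2 = j,
      stamped m C & bounded L m].
have t : triple (I 0) write_phase (I (n * n)) ((n * n).+1 * (K2 * L + K1 * L)).
  apply: h2 => // [j [[m ii] o] [-> _ _ _ bm]|j [[m ii] o] jn [_ _ [m1 m2] _ _]|
    [[m ii] o] [_ _ [m1 m2] _ _]|j jn].
  - by split.
  - by rewrite [(m, ii, o).1.1]/= !evalE m1 m2 /= subn_eq0 -ltnNge.
  - by rewrite [(m, ii, o).1.1]/= !evalE m1 m2 /= subnn.
  apply: h1 => // [[[m ii] o] [-> _ _ _ bm]|[[m ii] o] [-> -> [m1 m2] st bm]]; first by split.
  have -> : exec write_body (m, [::], [seq g k | k <- iota 0 j]) =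
      (upd (upd m 2 j.+1) 15 0, [::], [seq g k | k <- iota 0 j.+1]).
    rewrite /write_body !exec_block.
    have -> : exec (Write (Op Defs.Sub (Op Add (cell 2 (reg 2)) (Const 1)) (reg 10)))
        (m, [::], [seq g k | k <- iota 0 j]) = (m, [::], [seq g k | k <- iota 0 j.+1]).
      rewrite -[j.+1]addn1 iotaD map_cat /= cats1.
      rewrite -[LHS]/(m, [::], rcons _ _); congr (_, _, rcons _ _).
      rewrite !evalE m2 /= add0n addn1.
      have nn0 : 0 < n by [].
      have := st (inord (j %/ n)) (inord (j %% n)).
      rewrite !inordK ?ltn_mod ?ltn_divLR // -divn_eq /g => -[le <-].
      case: eqP => [->|ne]; first by rewrite subSnn.
      by apply/eqP; rewrite subn_eq0; lia.
    by rewrite !exec_put !evalE m2 /= addn1.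
  split=> //.
  - by do 2! (apply: stamped_upd_reg => //).
  - by do 2! (apply: bounded_upd; last by apply: sL; lia).
apply: triple_weaken t => [x|x|]; last by nia.
  case: x => [[m ii] o] [/= -> -> [m0 m1 m2 _ _ _ _ st bm]]; split=> //.
by case: x => [[m ii] o] [_ /= -> _ _ _]; rewrite /encode_cycle allpairs_ord.
Qed.

Definition sampler : cmd :=
  Seq read_phase (Seq forward_loop (Seq sample_init (Seq sample_loop write_phase))).

Lemma sampler_outcome : exists K, forall n' L (w : weights 'I_n'.+1) (s : seq 'I_n'.+1)
    (f : nat -> nat * nat * nat) M,
  small_bits n'.+1 L -> wellformed w -> mass w <= M -> nbits (2 * M ^ 3) <= L ->
  nbits ((M ^ 3) ^ (n'.+1 * n'.+1)) <= L ->
  size s = n'.+1 * n'.+1 ->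
  (forall j v0, j < n'.+1 * n'.+1 -> nth v0 s j = j %% n'.+1 :> nat) ->
  (forall v, v \in flatten [seq item f k | k <- iota 0 (n'.+1 * n'.+1)] -> nbits v <= L) ->
  (forall k, k < n'.+1 * n'.+1 -> nbits ((f k).2 + (1 - (f k).1.1)) <= L) ->
  (forall x y : 'I_n'.+1, ((f (x * n'.+1 + y)).1.2,
     (f (x * n'.+1 + y)).2 + (1 - (f (x * n'.+1 + y)).1.1)) = w [set x; y]) ->
  outcome (init sampler (n'.+1 :: flatten [seq item f k | k <- iota 0 (n'.+1 * n'.+1)]))
    (K * ((n'.+1 * n'.+1 + 3) * ((n'.+4) * L)))
    (fun y => law (trace w s) (fun C => (encode_cycle C == y)%:R%R)).
Proof.
have [K1 h1] := read_triple.
have [K2 h2] := forward_triple.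
have [K3 h3] := @triple_straight sample_init isT.
have [K4 h4] := sample_loop_outcome.
have [K5 h5] := write_triple.
exists (K1 + K2 + K3 + K4 + K5 + 4) => n' L w s f M sL ww wM ML ML' ss sn fL dL fw.
have L0 := small_bits_gt0 sL.
set n := n'.+1 in sL ss sn fL dL fw ML' *.
set rs := trace w s.
have rsn : size rs = n * n by rewrite size_trace.
have zL i : nbits (fraction_sum (drop i rs)).1 <= L /\ nbits (fraction_sum (drop i rs)).2 <= L.
  have -> : drop i rs = trace (foldl (@eliminate _) w (take i s)) (drop i s).
    rewrite /rs; elim: s w i {ss sn rs rsn ww wM fw} => [|v s IH] w [|i] //=; exact: IH.
  have := total_bound (drop i s) (wellformed_foldl (take i s) ww)
    (leq_trans (mass_foldl (take i s) ww) wM).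
  have M0 : 0 < M by apply: leq_trans (mass_gt0 ww) wM.
  have le : (M ^ 3) ^ size (drop i s) <= (M ^ 3) ^ (n * n).
    by rewrite leq_pexp2l ?expn_gt0 ?M0 // size_drop ss leq_subr.
  move=> /leq_trans /(_ le) h; split; apply: leq_trans ML'; apply: leq_nbits.
    exact: leq_trans (leq_addr _ _) h.
  exact: leq_trans (leq_addl _ _) h.
pose F (y : seq nat) (C : {set {set 'I_n'.+1}}) : rat := ((encode_cycle C == y)%:R)%R.
have fin C m t : sample_mem L rs 0 C m ->
    outcome ([:: write_phase], at_time (m, [::], [::]) t) (t + (K5 * ((n * n).+1 * L) + 0))
      (fun y => F y C).
  move=> sm; apply: outcome_triple (h5 n' L rs C sL) _ _ _ _ => // x t' e.
  by apply: outcome_halt => [|y]; rewrite /= ?addn0 // e.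
have smp m t : sample_mem L rs (n * n) set0 m ->
    outcome ([:: sample_loop; write_phase], at_time (m, [::], [::]) t)
      (t + ((n * n).+1 * (K4 * L) + (K5 * ((n * n).+1 * L) + 0)))
      (fun y => law rs (F y)).
  move=> sm; apply: outcome_ext (h4 n' L rs _ _ F sL zL rsn fin (n * n) _ _ t (leqnn _) sm).
  by move=> y; rewrite back_law rsn.
pose T5 := (n * n).+1 * (K4 * L) + (K5 * ((n * n).+1 * L) + 0).
have t3 : triple (silent (forward_mem L (foldl (@eliminate _) w s) rs (n * n))) sample_init
     (silent (sample_mem L rs (n * n) set0)) (K3 * L).
  apply: triple_loaded h3 _ _ _ => // [m []//|m]; exact: exec_sample_init.
have t2 := h2 n' L w s M sL ww wM ML ss sn.
have t1 := h1 n' L w f rs sL fL dL fw.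
have -> : init sampler (n :: flatten [seq item f k | k <- iota 0 (n * n)]) =
   ([:: sampler], at_time (fun=> 0, n :: flatten [seq item f k | k <- iota 0 (n * n)], [::]) 0) by [].
have run1 x t : x = (fun=> 0, n :: flatten [seq item f k | k <- iota 0 (n * n)], [::]) ->
   outcome ([:: sampler], at_time x t)
    (t + (K1 * ((n * n).+3 * L) + (K2 * ((n * n).+1 * (n'.+4 * L)) + (K3 * L + T5.+1).+1).+1).+1)
    (fun y => law rs (F y)).
  move=> ex; apply: outcome_seq => t'; apply: outcome_triple t1 _ _ _ ex => y t4 fm.
  apply: outcome_seq => t5; apply: outcome_triple t2 _ _ _ fm => y' t6 fm'.
  apply: outcome_seq => t7; apply: outcome_triple t3 _ _ _ fm' => -[[m ii] o] t8 [/= -> -> sm].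
  by apply: outcome_seq => t9; exact: smp.
apply: outcome_weaken (run1 _ 0 erefl) => //; rewrite add0n /T5; nia.
Qed.

(** * Correctness of the sampler *)

Lemma nth_flatten_nseq (T : Type) (x0 : T) k s j : j < k * size s ->
  nth x0 (flatten (nseq k s)) j = nth x0 s (j %% size s).
Proof.
elim: k j => [|k IH] j //=; rewrite mulSn => jk; rewrite nth_cat; case: ltnP => js.
  by rewrite modn_small.
by rewrite IH; [rewrite -[in RHS](subnKC js) modnDl | lia].
Qed.

Lemma size_flatten_nseq (T : Type) k (s : seq T) : size (flatten (nseq k s)) = k * size s.
Proof. by elim: k => //= k IH; rewrite size_cat IH mulSn. Qed.

(** * Weights read from the input, and their size *)

Section InitialWeights.
Variables (V : finType) (G : rel V) (c : {set V} -> rat).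
Hypotheses (sG : symmetric G) (iG : irreflexive G).
Hypothesis c_ge0 : forall E, E \in edge_set G -> (0 <= c E)%R.

Definition initial_weights : weights V :=
  [ffun E => if E \in edge_set G then (`|numq (c E)|, `|denq (c E)|)%N else (0, 1)].

Lemma mem_edge_set x y : ([set x; y] \in edge_set G) = G x y.
Proof.
rewrite inE; apply/existsP/idP => [[a /existsP[b /andP[Gab]]]|Gxy].
  by rewrite set2_eq => /orP[] /andP[/eqP -> /eqP ->] //; rewrite sG.
by exists x; apply/existsP; exists y; rewrite Gxy eqxx.
Qed.

Lemma wellformed_initial : wellformed initial_weights.
Proof.
split=> [E|x]; rewrite ffunE.
  by case: ifP => //= _; rewrite absz_gt0 denq_neq0.
by rewrite -[[set x]]setUid mem_edge_set iG.
Qed.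

Lemma adjacent_initial x y : adjacent initial_weights x y -> G x y.
Proof. by rewrite /adjacent ffunE mem_edge_set; case: ifP. Qed.

Lemma value_initial E : E \in edge_set G -> value initial_weights E = c E.
Proof.
move=> EG; rewrite /value ffunE EG /= -[RHS]divq_num_den.
have n0 : (0 <= numq (c E))%R by rewrite numq_ge0 c_ge0.
by rewrite !pmulrn !gez0_abs ?denq_ge0.
Qed.

Lemma sum_initial (f : {set {set V}} -> rat) :
  (\sum_(C | cyc C) cycle_weight (value initial_weights) C * f C =
   \sum_(C | simple_cycle G C) cycle_weight c C * f C)%R.
Proof.
rewrite (bigID (fun C : {set {set V}} => C \subset edge_set G)) /=.
rewrite [X in (_ + X)%R]big1 ?addr0 => [|C /andP[_ /subsetPn[E EC EG]]]; last first.
  by rewrite (cycle_weight0 EC) ?mul0r // /value ffunE (negPf EG) mul0r.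
apply: eq_big => C; first by rewrite simple_cycle_complete.
move=> /andP[_ /subsetP CG]; congr (_ * _)%R; apply: eq_cycle_weight => E /CG.
exact: value_initial.
Qed.

(** [mass] has one factor per edge, the input one entry per ordered pair. Passing to pairs only
    enlarges the product, since every factor is positive; with b the length of an entry, the
    exponent becomes at most the length of the input. *)
Lemma mass_initial B (b : V -> V -> nat) :
  (forall x y, G x y -> `|numq (c [set x; y])| + `|denq (c [set x; y])| <= 2 ^ b x y)%N ->
  (\sum_x \sum_y b x y <= B)%N -> mass initial_weights <= 2 ^ B.
Proof.
move=> hb hB; set M := fun E : {set V} => (`|numq (c E)| + `|denq (c E)|)%N.
have Mgt0 E : 0 < M E by rewrite /M addn_gt0 [X in _ || X]absz_gt0 denq_neq0 orbT.
have -> : mass initial_weights = \prod_(E in edge_set G) M E.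
  rewrite /mass [LHS](bigID (fun E => E \in edge_set G)) /= [X in _ * X]big1 => [|E EG].
    by rewrite muln1; apply: eq_bigr => E EG; rewrite ffunE EG.
  by rewrite ffunE (negPf EG).
pose D := [set p : V * V | G p.1 p.2].
pose h (p : V * V) := [set p.1; p.2].
have -> : edge_set G = h @: D.
  apply/setP => E; apply/idP/imsetP => [|[[x y]]].
    rewrite inE => /existsP[x /existsP[y /andP[Gxy /eqP ->]]].
    by exists (x, y); rewrite ?inE.
  by rewrite inE /= => Gxy ->; rewrite mem_edge_set.
apply: (@leq_trans (\prod_(p in D) M (h p))).
  rewrite [X in _ <= X](partition_big_imset h) /=; apply: leq_prod => E /imsetP[p pD ->].
  rewrite (bigD1 p) /= ?pD ?eqxx // leq_pmulr // prodn_gt0 // => q; exact: Mgt0.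
apply: (@leq_trans (\prod_(p : V * V) 2 ^ b p.1 p.2)).
  rewrite [X in _ <= X](bigID (fun p => p \in D)) /=.
  apply: (@leq_trans (\prod_(p in D) 2 ^ b p.1 p.2)).
    by apply: leq_prod => -[x y]; rewrite inE /= => /hb.
  by rewrite leq_pmulr // prodn_gt0 // => q; rewrite expn_gt0.
rewrite -expn_sum leq_exp2l //; apply: leq_trans hB.
by rewrite pair_big.
Qed.
End InitialWeights.

Lemma size_bits_cons v s : size_bits (v :: s) = nbits v + size_bits s.
Proof. by []. Qed.

Lemma size_bits_flatten (s : seq (seq nat)) : size_bits (flatten s) = sumn (map size_bits s).
Proof. by rewrite /size_bits map_flatten sumn_flatten -map_comp. Qed.

Lemma size_bits_mem v s : v \in s -> nbits v <= size_bits s.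
Proof.
elim: s => //= u s IH; rewrite inE => /predU1P[->|/IH h]; first exact: leq_addr.
exact: leq_trans h (leq_addl _ _).
Qed.

Lemma size_le_size_bits s : size s <= size_bits s.
Proof. by elim: s => //= u s IH; rewrite /size_bits /= -add1n leq_add. Qed.

Definition items n' (G : rel 'I_n'.+1) (c : {set 'I_n'.+1} -> rat) (k : nat) : nat * nat * nat :=
  let x := inord (k %/ n'.+1) in let y := inord (k %% n'.+1) in
  if G x y then (1, `|numq (c [set x; y])|, `|denq (c [set x; y])|)%N else (0, 0, 0).

Lemma encode_inputE n' (G : rel 'I_n'.+1) c :
  encode_input G c = n'.+1 :: flatten [seq item (items G c) k | k <- iota 0 (n'.+1 * n'.+1)].
Proof.
rewrite /encode_input allpairs_ord; congr (_ :: flatten _).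
by apply: eq_map => k; rewrite /item /items; case: ifP.
Qed.

Lemma items_flat n' (G : rel 'I_n'.+1) c (x y : 'I_n'.+1) :
  items G c (x * n'.+1 + y) =
  if G x y then (1, `|numq (c [set x; y])|, `|denq (c [set x; y])|)%N else (0, 0, 0).
Proof.
have xE : inord ((x * n'.+1 + y) %/ n'.+1) = x.
  by apply: val_inj; rewrite /= divnMDl // divn_small // addn0 inordK.
have yE : inord ((x * n'.+1 + y) %% n'.+1) = y.
  by apply: val_inj; rewrite /= modnMDl modn_small // inordK.
by rewrite /items xE yE.
Qed.

Lemma sum_ord_pairs n' (F : 'I_n'.+1 -> 'I_n'.+1 -> nat) :
  \sum_x \sum_y F x y =
  \sum_(k <- iota 0 (n'.+1 * n'.+1)) F (inord (k %/ n'.+1)) (inord (k %% n'.+1)).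
Proof.
have := congr1 sumn (allpairs_ord F); rewrite !sumnE big_map big_allpairs_dep => <-.
by rewrite big_enum; apply: eq_bigr => x _; rewrite big_enum.
Qed.

Theorem mainTheorem16 :
  exists (P : cmd) (p : {poly nat}),
  forall (n : nat) (G : rel 'I_n) (c : {set 'I_n} -> rat),
    symmetric G -> irreflexive G ->
    treewidth_at_most G 2 ->
    (forall E, E \in edge_set G -> (0 <= c E)%R) ->
    (exists C, simple_cycle G C /\ cycle_weight c C <> 0%R) ->
    samples_in_time P (encode_input G c)
      (p.[size_bits (encode_input G c)])%R
      (@encode_cycle n) (cycle_distr G c).
Proof.
have [K hK] := sampler_outcome.
(* 108 = 3 * 4 * 9, from n * n + 3 <= 3 B, n + 3 <= 4 B and L = 9 B^2, where B is the input size.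
   This gives degree 4, and the fifth power leaves a factor B to spare. *)
exists sampler, ((K * 108)%:P * 'X^5)%R => n G c sG iG tw c0 [C0 [cC0 wC0]].
case: n G c sG iG tw c0 C0 cC0 wC0 => [|n'] G c sG iG tw c0 C0 cC0 wC0.
  by case/simple_cycleP: cC0 => -[[]|[]].
set B := size_bits _.
have eB : B = size_bits (n'.+1 :: flatten [seq item (items G c) k | k <- iota 0 (n'.+1 * n'.+1)]).
  by rewrite /B encode_inputE.
set n := n'.+1 in G c sG iG tw c0 C0 cC0 wC0 B eB *.
pose w := initial_weights G c.
have ww : wellformed w by exact: wellformed_initial.
pose s := flatten (nseq n (enum 'I_n)).
have ss : size s = n * n by rewrite size_flatten_nseq size_enum_ord.
have sn j v0 : j < n * n -> nth v0 s j = j %% n :> nat.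
  by move=> jn; rewrite nth_flatten_nseq size_enum_ord // nth_enum_ord // ltn_pmod.
have ew : exhausted w s.
  have tw' : tw2 (adjacent w).
    by apply: tw2_sub (tw2_treewidth tw) => x y; exact: adjacent_initial.
  by have := eliminate_all ww tw'; rewrite card_ord.
(* The encoding has 3 n^2 + 1 items, each of at least one bit. *)
have nnB : n * n < B.
  rewrite eB; apply: leq_trans (size_le_size_bits _); rewrite /= ltnS.
  rewrite size_flatten /shape -map_comp sumnE big_map (eq_bigr (fun=> 3)) //.
  by rewrite big_const_seq count_predT size_iota iter_addn_0; nia.
have mB : mass w <= 2 ^ B.
  pose b (x y : 'I_n) := size_bits (item (items G c) (x * n + y)).
  apply: (@mass_initial _ _ _ _ _ b) => //.
    move=> x y Gxy; rewrite /b /item items_flat Gxy /size_bits /= addn0; set p := `|_|; set q := `|_|.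
    apply: ltnW; apply: leq_trans (ltn_nbits (p + q)) _; rewrite leq_exp2l //.
    by apply: leq_trans (nbits_add p q) _; exact: leq_addl.
  rewrite eB size_bits_cons; apply: (leq_trans _ (leq_addl _ _)).
  rewrite size_bits_flatten sumnE !big_map sum_ord_pairs.
  rewrite big_seq [X in _ <= X]big_seq; apply: leq_sum => k.
  rewrite mem_iota add0n => /andP[_ kn]; rewrite /b !inordK ?ltn_mod ?ltn_divLR //.
  by rewrite -divn_eq.
have B0 : 0 < B by lia.
(* The largest bound to accommodate is that of the partial sums, [(M ^ 3) ^ (n * n)] with M = 2 ^ B:
   at most 3 B n^2 + 1 bits, where n^2 < B. The factor 9 leaves room for the other quantities. *)
pose L := 9 * B ^ 2.
have LB : B ^ 2 <= L by rewrite /L; nia.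
have BL : B <= L by rewrite /L expnS expn1; nia.
have sL : small_bits n L.
  by move=> k kn; apply: leq_trans (nbits_id k) _; rewrite /L expnS expn1; nia.
have pow_bits e : nbits (2 ^ e) <= e.+1 by rewrite nbits_le // ltn_exp2l.
have iB k : k < n * n -> forall v, v \in item (items G c) k -> nbits v <= B.
  move=> kn v vi; rewrite eB; apply: size_bits_mem; rewrite inE; apply/orP; right.
  apply/flattenP; exists (item (items G c) k) => //.
  by apply: map_f; rewrite mem_iota.
have out := hK n' L w s (items G c) (2 ^ B) sL ww mB _ _ ss sn _ _ _.
have {out} [N0 hN] : outcome (init sampler (encode_input G c))
    (K * ((n * n + 3) * ((n'.+4) * L)))
    (fun y => law (trace w s) (fun C => (encode_cycle C == y)%:R%R)).
  rewrite encode_inputE; apply: out.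
  - rewrite -expnM -expnS; apply: leq_trans (pow_bits _) _; rewrite /L expnS expn1; nia.
  - rewrite -!expnM; apply: leq_trans (pow_bits _) _; rewrite /L expnS expn1; nia.
  - move=> v /flattenP[l /mapP[k]]; rewrite mem_iota add0n => /andP[_ kn] -> vi.
    exact: leq_trans (iB k kn v vi) BL.
  - move=> k kn; have := iB k kn (items G c k).2; rewrite /item !inE eqxx !orbT.
    move=> /(_ isT) h; apply: leq_trans BL; rewrite /items in h *.
    by case: ifP h => //=; rewrite addn0.
  - move=> x y; by rewrite items_flat ffunE mem_edge_set //; case: ifP => //=; rewrite addn0.
have [halts lawE] := hN N0 (leqnn _).
exists N0; split.
  apply: sub_all halts => b /andP[-> le] /=; apply/orP; right; apply: leq_trans le _.
  rewrite hornerCM hornerXn -[X in _ <= X]/(K * 108 * B ^ 5) -mulnA leq_mul2l; apply/orP; right.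
  have h1 : n * n + 3 <= 3 * B by lia.
  have h2 : n'.+4 <= 4 * B by move: nnB; rewrite /n; clear; nia.
  apply: leq_trans (leq_mul h1 (leq_mul h2 (leqnn L))) _; rewrite /L.
  have -> : 3 * B * (4 * B * (9 * B ^ 2)) = 108 * B ^ 4 by ring.
  by rewrite leq_mul // leq_pexp2l.
move=> y; rewrite lawE.
pose g (C : {set {set 'I_n}}) : rat := ((encode_cycle C == y)%:R)%R.
have lc := law_correct g ww ew; rewrite (sum_initial sG iG c0) in lc.
pose Z : rat := (\sum_(D | simple_cycle G D) cycle_weight c D)%R.
have tc : total_value (trace w s) = Z.
  rewrite total_correct //; under eq_bigr do rewrite -[cycle_weight _ _]mulr1.
  by rewrite (sum_initial sG iG c0 (fun=> 1%R)); apply: eq_bigr => C _; rewrite mulr1.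
have ge0 C : simple_cycle G C -> (0 <= cycle_weight c C)%R.
  rewrite simple_cycle_complete // => /andP[_ /subsetP CG].
  by apply: prodr_ge0 => E /CG /c0.
have Z0 : Z != 0%R.
  rewrite psumr_neq0 //; apply/hasP; exists C0; rewrite ?mem_index_enum // cC0 /=.
  by rewrite lt_neqAle ge0 // andbT eq_sym; apply/eqP.
transitivity ((\sum_(C | simple_cycle G C) cycle_weight c C * g C) / Z)%R.
  by rewrite -lc tc mulrAC divff // mul1r.
rewrite mulr_suml big_mkcond [RHS]big_mkcond; apply: eq_bigr => C _.
rewrite /cycle_distr -/Z /g; case: ifP => _; case: ifP => _ //.
  by rewrite mulr1.
by rewrite mulr0 mul0r.
Qed.
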